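(* Let $\mathcal E:0\to V\to\widehat{\mathfrak p}\xrightarrow{p}\mathfrak p\to0$ be an abelian extension of crossed modules over Leibniz algebras, with $V=(V_1,V_0,\varphi)$, $\mathfrak p=(\mathfrak p_1,\mathfrak p_0,f)$, section $\sigma$, induced representation $\rho$ of $\mathfrak p$ on $V$ and associated 2-cocycle $(\theta,\omega,\mu,\nu)$. Then there is an exact sequence $$0\to Z^1(\mathfrak p,V)\xrightarrow{\ i\ }\mathrm{Aut}_V(\widehat{\mathfrak p})\xrightarrow{\ \Phi\ }C_\rho(\mathfrak p,V)\xrightarrow{\ \varpi_{\mathcal E}\ }H^2(\mathfrak p,V),$$ where $i(\lambda)=F_\lambda$, $\Phi(F)=(F|_V,\overline F)$ and $\varpi_{\mathcal E}$ is the Wells map; that is, $i$ is an injective group homomorphism, $\Phi$ is a group homomorphism, $\operatorname{im}i=\ker\Phi$ and $\operatorname{im}\Phi=\{(\beta,\alpha)\in C_\rho(\mathfrak p,V):\varpi_{\mathcal E}(\beta,\alpha)=0\}$.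
   Context: All vector spaces are over a fixed field. A Leibniz algebra is a vector space with a bilinear bracket satisfying $[x,[y,z]]=[[x,y],z]+[y,[x,z]]$. A representation of a Leibniz algebra $\mathfrak p_0$ is a vector space $M$ with bilinear maps $\mathfrak p_0\otimes M\to M$, $M\otimes\mathfrak p_0\to M$ (both written $\cdot$) with $[x,y]\cdot m=x\cdot(y\cdot m)-y\cdot(x\cdot m)$; $m\cdot[x,y]=(m\cdot x)\cdot y+x\cdot(m\cdot y)$; $m\cdot[x,y]=x\cdot(m\cdot y)-(x\cdot m)\cdot y$. A crossed module over Leibniz algebra is a triple $(\mathfrak p_1,\mathfrak p_0,f)$ with $\mathfrak p_0$ a Leibniz algebra, $\mathfrak p_1$ a representation of $\mathfrak p_0$, and $f:\mathfrak p_1\to\mathfrak p_0$ linear with $f(x\cdot a)=[x,f(a)]$, $f(a\cdot x)=[f(a),x]$ and $f(a)\cdot b=a\cdot f(b)$. Write $[x,a]=x\cdot a$, $[a,x]=a\cdot x$. A homomorphism $F=(F_0,F_1)$ consists of linear maps $F_i:\mathfrak p_i\to\mathfrak p_i'$ with $F_0f=f'F_1$, $F_0[x,y]=[F_0x,F_0y]'$, $F_1[x,a]=[F_0x,F_1a]'$, $F_1[a,x]=[F_1a,F_0x]'$; it is an automorphism if it is an endomorphism with $F_0,F_1$ bijective. An extension of $(\mathfrak p_1,\mathfrak p_0,f)$ by $(V_1,V_0,\varphi)$ is a sequence $0\to V\to\widehat{\mathfrak p}\xrightarrow{p}\mathfrak p\to0$ of crossed modules and homomorphisms, short exact in each degree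 ($V\to\widehat{\mathfrak p}$ regarded as an inclusion), $\widehat{\mathfrak p}=(\widehat{\mathfrak p}_1,\widehat{\mathfrak p}_0,\widehat f)$. It is abelian if the bracket on $V_0$ is zero and the actions of $V_0$ on $V_1$ are zero. A section is a pair of linear maps $\sigma_i:\mathfrak p_i\to\widehat{\mathfrak p}_i$ with $p_i\sigma_i=\mathrm{id}$. For $x,y\in\mathfrak p_0$, $a\in\mathfrak p_1$, $w\in V_0$, $m\in V_1$, the representation $\rho=(l_0,r_0,l_1,r_1)$ is: $l_0(x)(w+m)=[\sigma_0x,w+m]$, $r_0(x)(w+m)=[w+m,\sigma_0x]$, $l_1(a)(w)=[\sigma_1a,w]$, $r_1(a)(w)=[w,\sigma_1a]$; the associated 2-cocycle is $\theta(a)=\widehat f\sigma_1(a)-\sigma_0(f(a))$, $\omega(x,y)=[\sigma_0x,\sigma_0y]-\sigma_0[x,y]$, $\mu(x,a)=[\sigma_0x,\sigma_1a]-\sigma_1[x,a]$, $\nu(a,x)=[\sigma_1a,\sigma_0x]-\sigma_1[a,x]$. Cohomology. For $\lambda=(\lambda_0,\lambda_1)\in\mathrm{Hom}(\mathfrak p_0,V_0)\oplus\mathrm{Hom}(\mathfrak p_1,V_1)$ let $\partial\lambda=(\theta,\omega,\mu,\nu)$ with $\theta(a)=\varphi\lambda_1(a)-\lambda_0f(a)$; $\omega(x,y)=l_0(x)\lambda_0(y)+r_0(y)\lambda_0(x)-\lambda_0[x,y]$; $\mu(x,a)=l_0(x)\lambda_1(a)+r_1(a)\lambda_0(x)-\lambda_1[x,a]$;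 $\nu(a,x)=l_1(a)\lambda_0(x)+r_0(x)\lambda_1(a)-\lambda_1[a,x]$. $Z^1(\mathfrak p,V)$ is the additive group of $\lambda$ with $\partial\lambda=0$. $Z^2(\mathfrak p,V)$ is the space of tuples $(\theta,\omega,\mu,\nu)$, $\theta\in\mathrm{Hom}(\mathfrak p_1,V_0)$, $\omega\in\mathrm{Hom}(\mathfrak p_0^{\otimes2},V_0)$, $\mu\in\mathrm{Hom}(\mathfrak p_0\otimes\mathfrak p_1,V_1)$, $\nu\in\mathrm{Hom}(\mathfrak p_1\otimes\mathfrak p_0,V_1)$, such that $(\mathfrak p_1\oplus V_1,\mathfrak p_0\oplus V_0)$ is a crossed module over Leibniz algebra under $a+m\mapsto f(a)+\theta(a)+\varphi(m)$; $[x+u,y+v]=[x,y]+\omega(x,y)+l_0(x)v+r_0(y)u$; $[x+u,a+m]=[x,a]+\mu(x,a)+l_0(x)m+r_1(a)u$; $[a+m,x+u]=[a,x]+\nu(a,x)+l_1(a)u+r_0(x)m$. $B^2(\mathfrak p,V)$ is the space of all $\partial\lambda$ and $H^2=Z^2/B^2$. $\mathrm{Aut}(V)$, $\mathrm{Aut}(\mathfrak p)$ are the groups of crossed module automorphisms. $\mathrm{Aut}_V(\widehat{\mathfrak p})$ is the group of automorphisms $F$ of $\widehat{\mathfrak p}$ with $F_0(V_0)=V_0$, $F_1(V_1)=V_1$; $F|_V=(F_0|_{V_0},F_1|_{V_1})$, $\overline F=(p_0F_0\sigma_0,p_1F_1\sigma_1)$. $C_\rho(\mathfrak p,V)$ is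 the subgroup of $(\beta,\alpha)\in\mathrm{Aut}(V)\times\mathrm{Aut}(\mathfrak p)$ with $\beta_0l_0(x)\beta_0^{-1}=l_0(\alpha_0x)$ and $\beta_0r_0(x)\beta_0^{-1}=r_0(\alpha_0x)$ on $V_0$, $\beta_1l_0(x)\beta_1^{-1}=l_0(\alpha_0x)$ and $\beta_1r_0(x)\beta_1^{-1}=r_0(\alpha_0x)$ on $V_1$, $\beta_1r_1(a)\beta_0^{-1}=r_1(\alpha_1a)$, $\beta_1l_1(a)\beta_0^{-1}=l_1(\alpha_1a)$ for all $x\in\mathfrak p_0$, $a\in\mathfrak p_1$. For $\lambda\in Z^1(\mathfrak p,V)$: $F_{\lambda,0}(\sigma_0x+v)=\sigma_0x+\lambda_0(x)+v$, $F_{\lambda,1}(\sigma_1a+m)=\sigma_1a+\lambda_1(a)+m$. Wells map: for $(\beta,\alpha)\in C_\rho(\mathfrak p,V)$ let $(\theta,\omega,\mu,\nu)_{(\beta,\alpha)}$ be the 2-cocycle with components $\beta_0\theta(\alpha_1^{-1}a)$, $\beta_0\omega(\alpha_0^{-1}x,\alpha_0^{-1}y)$, $\beta_1\mu(\alpha_0^{-1}x,\alpha_1^{-1}a)$, $\beta_1\nu(\alpha_1^{-1}a,\alpha_0^{-1}x)$, and $\varpi_{\mathcal E}(\beta,\alpha)=[(\theta,\omega,\mu,\nu)_{(\beta,\alpha)}]-[(\theta,\omega,\mu,\nu)]$ (a map, not necessarily a homomorphism). *)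

(* Defs.v *)
From HB Require Import structures.
From mathcomp Require Import all_boot all_algebra.
From mathcomp Require Import boolp classical_sets functions.

Set Implicit Arguments.
Unset Strict Implicit.
Unset Printing Implicit Defensive.

Import GRing.Theory.

Local Open Scope quotient_scope.
Local Open Scope classical_set_scope.
Local Open Scope ring_scope.

Notation bilin f := (bilinear_for *:%R *:%R f).

Section CrossedModules.
Variable K : fieldType.

Definition leibniz (A : lmodType K) (br : A -> A -> A) : Prop :=
  bilin br /\
  (forall x y z, br x (br y z) = br (br x y) z + br y (br x z)).

Definition leibniz_rep (A M : lmodType K) (br : A -> A -> A)
    (la : A -> M -> M) (ra : M -> A -> M) : Prop :=
  [/\ bilin la, bilin ra,
      forall x y m, la (br x y) m = la x (la y m) - la y (la x m),
      forall x y m, ra m (br x y) = ra (ra m x) y + la x (ra m y)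
    & forall x y m, ra m (br x y) = la x (ra m y) - ra (la x m) y].

Definition xmod_axiom (A0 A1 : lmodType K) (f : A1 -> A0)
    (br : A0 -> A0 -> A0) (la : A0 -> A1 -> A1) (ra : A1 -> A0 -> A1) : Prop :=
  [/\ leibniz br, leibniz_rep br la ra, linear f
    & [/\ forall x a, f (la x a) = br x (f a),
          forall a x, f (ra a x) = br (f a) x
        & forall a b, la (f a) b = ra a (f b)]].

Record xmod := XMod {
  deg0 : lmodType K;
  deg1 : lmodType K;
  bdry : deg1 -> deg0;
  brk : deg0 -> deg0 -> deg0;
  lact : deg0 -> deg1 -> deg1;
  ract : deg1 -> deg0 -> deg1;
  xmodP : xmod_axiom bdry brk lact ract
}.

Definition xhom_axiom (A B : xmod)
    (F0 : deg0 A -> deg0 B) (F1 : deg1 A -> deg1 B) : Prop :=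
  [/\ linear F0, linear F1,
      forall a, F0 (bdry a) = bdry (F1 a),
      forall x y, F0 (brk x y) = brk (F0 x) (F0 y)
    & (forall x a, F1 (lact x a) = lact (F0 x) (F1 a)) /\
      (forall a x, F1 (ract a x) = ract (F1 a) (F0 x))].

Record xaut (A : xmod) := XAut {
  aut0 : deg0 A -> deg0 A;
  aut1 : deg1 A -> deg1 A;
  aut_hom : xhom_axiom aut0 aut1;
  aut_bij0 : bijective aut0;
  aut_bij1 : bijective aut1
}.

(* V is not required to be a subspace of the middle term: the inclusion is an
   explicit injection (inc0, inc1). *)
Record extension (V P : xmod) := Extension {
  mid : xmod;
  inc0 : deg0 V -> deg0 mid;
  inc1 : deg1 V -> deg1 mid;
  prj0 : deg0 mid -> deg0 P;
  prj1 : deg1 mid -> deg1 P;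
  inc_hom : xhom_axiom inc0 inc1;
  prj_hom : xhom_axiom prj0 prj1;
  inc0_inj : injective inc0;
  inc1_inj : injective inc1;
  ext_exact0 : forall e, prj0 e = 0 <-> exists v, inc0 v = e;
  ext_exact1 : forall e, prj1 e = 0 <-> exists v, inc1 v = e;
  prj0_surj : forall x, exists e, prj0 e = x;
  prj1_surj : forall a, exists e, prj1 e = a
}.

Definition abelian_xmod (V : xmod) : Prop :=
  [/\ forall u v : deg0 V, brk u v = 0,
      forall (u : deg0 V) (m : deg1 V), lact u m = 0
    & forall (m : deg1 V) (u : deg0 V), ract m u = 0].

Record abelian_extension (V P : xmod) := AbelianExtension {
  abext :> extension V P;
  abextP : abelian_xmod V
}.

Record section (V P : xmod) (E : extension V P) := MkSection {
  sec0 : deg0 P -> deg0 (mid E);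
  sec1 : deg1 P -> deg1 (mid E);
  sec0_lin : linear sec0;
  sec1_lin : linear sec1;
  sec0K : cancel sec0 (@prj0 V P E);
  sec1K : cancel sec1 (@prj1 V P E)
}.

(* rho = (l0, r0, l1, r1); l0 and r0 act on V0 + V1 preserving degrees and are
   split into their two components. In r00, r01 and r1 the element of P comes
   first: r00 x w = [w, sigma0 x]. *)
Record actions (V P : xmod) := Actions {
  l00 : deg0 P -> deg0 V -> deg0 V;
  l01 : deg0 P -> deg1 V -> deg1 V;
  r00 : deg0 P -> deg0 V -> deg0 V;
  r01 : deg0 P -> deg1 V -> deg1 V;
  l1 : deg1 P -> deg0 V -> deg1 V;
  r1 : deg1 P -> deg0 V -> deg1 V
}.

Section Cochains.
Variables V P : xmod.

Definition cochain1 := ((deg0 P -> deg0 V) * (deg1 P -> deg1 V))%type.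

Definition cochain2 :=
  ((deg1 P -> deg0 V) * (deg0 P -> deg0 P -> deg0 V) *
   (deg0 P -> deg1 P -> deg1 V) * (deg1 P -> deg0 P -> deg1 V))%type.

Definition theta (c : cochain2) := c.1.1.1.
Definition omega (c : cochain2) := c.1.1.2.
Definition mu (c : cochain2) := c.1.2.
Definition nu (c : cochain2) := c.2.

Variable rho : actions V P.

Definition coboundary (l : cochain1) : cochain2 :=
  (fun a => bdry (l.2 a) - l.1 (bdry a),
   fun x y => l00 rho x (l.1 y) + r00 rho y (l.1 x) - l.1 (brk x y),
   fun x a => l01 rho x (l.2 a) + r1 rho a (l.1 x) - l.2 (lact x a),
   fun a x => l1 rho a (l.1 x) + r01 rho x (l.2 a) - l.2 (ract a x)).

(* Hom spaces are cut out of the spaces of all functions, so linearity is part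
   of the cocycle conditions. *)
Definition cocycle1 (l : cochain1) : Prop :=
  [/\ linear l.1, linear l.2 & coboundary l = 0].

Section TwistedProduct.
Variable c : cochain2.

Definition tw_bdry (a : deg1 P * deg1 V) : deg0 P * deg0 V :=
  (bdry a.1, theta c a.1 + bdry a.2).

Definition tw_brk (x y : deg0 P * deg0 V) : deg0 P * deg0 V :=
  (brk x.1 y.1, omega c x.1 y.1 + l00 rho x.1 y.2 + r00 rho y.1 x.2).

Definition tw_lact (x : deg0 P * deg0 V) (a : deg1 P * deg1 V) :
    deg1 P * deg1 V :=
  (lact x.1 a.1, mu c x.1 a.1 + l01 rho x.1 a.2 + r1 rho a.1 x.2).

Definition tw_ract (a : deg1 P * deg1 V) (x : deg0 P * deg0 V) :
    deg1 P * deg1 V :=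
  (ract a.1 x.1, nu c a.1 x.1 + l1 rho a.1 x.2 + r01 rho x.1 a.2).

Definition tw_xmod : Prop := xmod_axiom tw_bdry tw_brk tw_lact tw_ract.

Definition cocycle2 : Prop :=
  [/\ linear (theta c), bilin (omega c), bilin (mu c), bilin (nu c) & tw_xmod].

End TwistedProduct.
End Cochains.

Section LinearFacts.
Variables (A B C : lmodType K).

Lemma linD (f : A -> B) : linear f -> {morph f : x y / x + y}.
Proof. by move=> h x y; have := h 1 x y; rewrite !scale1r. Qed.

Lemma lin0 (f : A -> B) : linear f -> f 0 = 0.
Proof.
by move=> h; have := linD h 0 0; rewrite addr0 -[LHS]addr0 => /addrI.
Qed.

Lemma linZ (f : A -> B) k x : linear f -> f (k *: x) = k *: f x.
Proof. by move=> h; have := h k x 0; rewrite lin0 // !addr0. Qed.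

Lemma linN (f : A -> B) : linear f -> {morph f : x / - x}.
Proof. by move=> h x; rewrite -scaleN1r linZ // scaleN1r. Qed.

Lemma linB (f : A -> B) : linear f -> {morph f : x y / x - y}.
Proof. by move=> h x y; rewrite linD // linN. Qed.

Lemma lin_comp (f : A -> B) (g : B -> C) :
  linear f -> linear g -> linear (g \o f).
Proof. by move=> hf hg k x y /=; rewrite hf hg. Qed.

Lemma lin_inv (f : A -> B) (g : B -> A) :
  linear f -> cancel f g -> cancel g f -> linear g.
Proof.
by move=> hf fK gK k x y; apply: (can_inj fK); rewrite gK hf !gK.
Qed.

End LinearFacts.

Lemma rearr (W : zmodType) (a b u v w u' v' w' : W) :
  (a - b) + (u - v + w) + (u' - v' + w') =
  (a + u + u') - (b + v + v') + (0 + w + w').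
Proof.
rewrite add0r !opprD.
by rewrite [LHS](AC (2*3*3)%AC ((1*3*6)*(2*4*7)*(5*8))%AC).
Qed.

Lemma bilinP (A B C : lmodType K) (f : A -> B -> C) :
  (forall y, linear (f ^~ y)) -> (forall x, linear (f x)) -> bilin f.
Proof. by []. Qed.

(* The axioms of a crossed module pass along a relation that is functional,
   onto the target and compatible with all the operations. *)
Lemma xmod_transfer (A0 A1 B0 B1 : lmodType K)
    (f : A1 -> A0) (br : A0 -> A0 -> A0) (la : A0 -> A1 -> A1)
    (ra : A1 -> A0 -> A1)
    (f' : B1 -> B0) (br' : B0 -> B0 -> B0) (la' : B0 -> B1 -> B1)
    (ra' : B1 -> B0 -> B1) (R0 : A0 -> B0 -> Prop) (R1 : A1 -> B1 -> Prop) :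
  xmod_axiom f br la ra ->
  (forall b, exists a, R0 a b) -> (forall b, exists a, R1 a b) ->
  (forall a b b', R0 a b -> R0 a b' -> b = b') ->
  (forall a b b', R1 a b -> R1 a b' -> b = b') ->
  (forall k a a' b b', R0 a b -> R0 a' b' -> R0 (k *: a + a') (k *: b + b')) ->
  (forall k a a' b b', R1 a b -> R1 a' b' -> R1 (k *: a + a') (k *: b + b')) ->
  (forall a b, R1 a b -> R0 (f a) (f' b)) ->
  (forall a b a' b', R0 a b -> R0 a' b' -> R0 (br a a') (br' b b')) ->
  (forall a b a' b', R0 a b -> R1 a' b' -> R1 (la a a') (la' b b')) ->
  (forall a b a' b', R1 a b -> R0 a' b' -> R1 (ra a a') (ra' b b')) ->
  xmod_axiom f' br' la' ra'.
Proof.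
move=> [[brl jac] [lal ral m1 m2 m3] fl [e1 e2 e3]] t0 t1 u0 u1 l0 l1 hf hb hl hr.
have add0 a a' b b' : R0 a b -> R0 a' b' -> R0 (a + a') (b + b').
  by move=> h h'; have := l0 1 _ _ _ _ h h'; rewrite !scale1r.
have add1 a a' b b' : R1 a b -> R1 a' b' -> R1 (a + a') (b + b').
  by move=> h h'; have := l1 1 _ _ _ _ h h'; rewrite !scale1r.
have sub1 a a' b b' : R1 a b -> R1 a' b' -> R1 (a - a') (b - b').
  move=> h h'; have := l1 (-1) _ _ _ _ h' h.
  by rewrite !scaleN1r ![- _ + _]addrC.
split; [split|split| |split].
- apply: bilinP => [z k x y|x k y z].
  + have [[[a ha] [b hb']] [c hc]] := (t0 x, t0 y, t0 z).
    apply: (u0 (br (k *: a + b) c)); first by apply: hb => //; apply: l0.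
    by rewrite brl.1; apply: l0; apply: hb.
  + have [[[a ha] [b hb']] [c hc]] := (t0 x, t0 y, t0 z).
    apply: (u0 (br a (k *: b + c))); first by apply: hb => //; apply: l0.
    by rewrite brl.2; apply: l0; apply: hb.
- move=> x y z; have [[[a ha] [b hb']] [c hc]] := (t0 x, t0 y, t0 z).
  apply: (u0 (br a (br b c))); first by apply: (hb) => //; apply: (hb).
  by rewrite jac; apply: add0; apply: (hb) => //; apply: (hb).
- apply: bilinP => [z k x y|x k y z].
  + have [[[a ha] [b hb']] [c hc]] := (t0 x, t0 y, t1 z).
    apply: (u1 (la (k *: a + b) c)); first by apply: hl => //; apply: l0.
    by rewrite lal.1; apply: l1; apply: hl.
  + have [[[a ha] [b hb']] [c hc]] := (t0 x, t1 y, t1 z).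
    apply: (u1 (la a (k *: b + c))); first by apply: hl => //; apply: l1.
    by rewrite lal.2; apply: l1; apply: hl.
- apply: bilinP => [z k x y|x k y z].
  + have [[[a ha] [b hb']] [c hc]] := (t1 x, t1 y, t0 z).
    apply: (u1 (ra (k *: a + b) c)); first by apply: hr => //; apply: l1.
    by rewrite ral.1; apply: l1; apply: hr.
  + have [[[a ha] [b hb']] [c hc]] := (t1 x, t0 y, t0 z).
    apply: (u1 (ra a (k *: b + c))); first by apply: hr => //; apply: l0.
    by rewrite ral.2; apply: l1; apply: hr.
- move=> x y z; have [[[a ha] [b hb']] [c hc]] := (t0 x, t0 y, t1 z).
  apply: (u1 (la (br a b) c)); first by apply: (hl) => //; apply: (hb).
  by rewrite m1; apply: sub1; apply: (hl) => //; apply: (hl).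
- move=> x y z; have [[[a ha] [b hb']] [c hc]] := (t0 x, t0 y, t1 z).
  apply: (u1 (ra c (br a b))); first by apply: (hr) => //; apply: (hb).
  rewrite m2; apply: add1; first by apply: (hr) => //; apply: (hr).
  by apply: (hl) => //; apply: (hr).
- move=> x y z; have [[[a ha] [b hb']] [c hc]] := (t0 x, t0 y, t1 z).
  apply: (u1 (ra c (br a b))); first by apply: (hr) => //; apply: (hb).
  rewrite m3; apply: sub1; first by apply: (hl) => //; apply: (hr).
  by apply: (hr) => //; apply: (hl).
- move=> k x y; have [[a ha] [b hb']] := (t1 x, t1 y).
  apply: (u0 (f (k *: a + b))); first by apply: hf; apply: l1.
  by rewrite fl; apply: l0; apply: hf.
- move=> x y; have [[a ha] [b hb']] := (t0 x, t1 y).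
  apply: (u0 (f (la a b))); first by apply: hf; apply: hl.
  by rewrite e1; apply: (hb) => //; apply: (hf).
- move=> y x; have [[a ha] [b hb']] := (t0 x, t1 y).
  apply: (u0 (f (ra b a))); first by apply: hf; apply: hr.
  by rewrite e2; apply: (hb) => //; apply: (hf).
- move=> x y; have [[a ha] [b hb']] := (t1 x, t1 y).
  apply: (u1 (la (f a) b)); first by apply: (hl) => //; apply: (hf).
  by rewrite e3; apply: (hr) => //; apply: (hf).
Qed.

Lemma xmod_prod (A0 A1 B0 B1 : lmodType K)
    (f : A1 -> A0) (br : A0 -> A0 -> A0) (la : A0 -> A1 -> A1)
    (ra : A1 -> A0 -> A1)
    (f' : B1 -> B0) (br' : B0 -> B0 -> B0) (la' : B0 -> B1 -> B1)
    (ra' : B1 -> B0 -> B1) :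
  xmod_axiom f br la ra -> xmod_axiom f' br' la' ra' ->
  xmod_axiom (fun a : A1 * B1 => (f a.1, f' a.2) : A0 * B0)
    (fun x y => (br x.1 y.1, br' x.2 y.2))
    (fun x a => (la x.1 a.1, la' x.2 a.2))
    (fun a x => (ra a.1 x.1, ra' a.2 x.2)).
Proof.
move=> [[brl jac] [lal ral m1 m2 m3] fl [e1 e2 e3]].
move=> [[brl' jac'] [lal' ral' m1' m2' m3'] fl' [e1' e2' e3']].
split; [split|split| |split].
- apply: bilinP => y k u v; apply: injective_projections => /=.
  + exact: brl.1.
  + exact: brl'.1.
  + exact: brl.2.
  + exact: brl'.2.
- by move=> *; apply: injective_projections; [exact: jac | exact: jac'].
- apply: bilinP => y k u v; apply: injective_projections => /=.
  + exact: lal.1.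
  + exact: lal'.1.
  + exact: lal.2.
  + exact: lal'.2.
- apply: bilinP => y k u v; apply: injective_projections => /=.
  + exact: ral.1.
  + exact: ral'.1.
  + exact: ral.2.
  + exact: ral'.2.
- by move=> *; apply: injective_projections; [exact: m1 | exact: m1'].
- by move=> *; apply: injective_projections; [exact: m2 | exact: m2'].
- by move=> *; apply: injective_projections; [exact: m3 | exact: m3'].
- by move=> k u v; apply: injective_projections; [exact: fl | exact: fl'].
- by move=> *; apply: injective_projections; [exact: e1 | exact: e1'].
- by move=> *; apply: injective_projections; [exact: e2 | exact: e2'].
- by move=> *; apply: injective_projections; [exact: e3 | exact: e3'].
Qed.

Lemma subr_cancel2 (W : zmodType) (a b c d e : W) :
  (a + b - c) + (d - a) + (e - b) = d + e - c.
Proof.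
by rewrite [LHS](AC (3*2*2)%AC ((4*6*3)*(1*5)*(2*7))%AC) /= !subrr !addr0.
Qed.

Lemma subrACA (W : zmodType) (a b c d e f : W) :
  (a - b) + (c - d) - (e - f) = (a + c - e) - (b + d - f).
Proof.
by rewrite !opprD !opprK [LHS](AC (2*2*2)%AC ((1*3*5)*(2*4*6))%AC).
Qed.

Lemma linear0 (A B : lmodType K) : linear (0 : A -> B).
Proof. by move=> k x y; rewrite /GRing.zero /= scaler0 addr0. Qed.

Lemma linearB_fct (A B : lmodType K) (f g : A -> B) :
  linear f -> linear g -> linear (f - g).
Proof.
move=> hf hg k x y.
change (f (k *: x + y) - g (k *: x + y) = k *: (f x - g x) + (f y - g y)).
by rewrite hf hg opprD scalerBr addrACA.
Qed.

Section BilinearFacts.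
Variables (A B C : lmodType K) (f : A -> B -> C) (hf : bilin f).

Lemma bilDl x y z : f (x + y) z = f x z + f y z.
Proof. exact: (linD (hf.1 z)). Qed.

Lemma bilDr x y z : f x (y + z) = f x y + f x z.
Proof. exact: (linD (hf.2 x)). Qed.

Lemma bil0l z : f 0 z = 0.
Proof. exact: (lin0 (hf.1 z)). Qed.

Lemma bil0r x : f x 0 = 0.
Proof. exact: (lin0 (hf.2 x)). Qed.

Lemma bilBl x y z : f (x - y) z = f x z - f y z.
Proof. exact: (linB (hf.1 z)). Qed.

Lemma bilBr x y z : f x (y - z) = f x y - f x z.
Proof. exact: (linB (hf.2 x)). Qed.

End BilinearFacts.

Lemma brk_bil (A : xmod) : bilin (@brk A).
Proof. by have [[]] := xmodP A. Qed.

Lemma lact_bil (A : xmod) : bilin (@lact A).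
Proof. by have [_ []] := xmodP A. Qed.

Lemma ract_bil (A : xmod) : bilin (@ract A).
Proof. by have [_ []] := xmodP A. Qed.

Lemma bdry_lin (A : xmod) : linear (@bdry A).
Proof. by have [] := xmodP A. Qed.

Section AutGroup.
Variable A : xmod.

HB.instance Definition _ := gen_eqMixin (xaut A).
HB.instance Definition _ := gen_choiceMixin (xaut A).

Lemma xaut_ext (F G : xaut A) :
  (forall x, aut0 F x = aut0 G x) -> (forall a, aut1 F a = aut1 G a) -> F = G.
Proof.
case: F G => [f0 f1 h b0 b1] [g0 g1 h' b0' b1'] /= /funext e0 /funext e1.
by move: h b0 b1 h' b0' b1'; rewrite e0 e1 => *; congr XAut; apply: Prop_irrelevance.
Qed.

Lemma xhom_id : xhom_axiom (@id (deg0 A)) (@id (deg1 A)).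
Proof. by []. Qed.

Lemma id_bij (T : Type) : bijective (@id T).
Proof. by exists id. Qed.

Definition xaut_one : xaut A := XAut xhom_id (@id_bij _) (@id_bij _).

Lemma xhom_comp (B C D : xmod) f0 f1 g0 g1 :
  @xhom_axiom C D f0 f1 -> @xhom_axiom B C g0 g1 ->
  xhom_axiom (f0 \o g0) (f1 \o g1).
Proof.
move=> [p1 p2 p3 p4 [p5 p6]] [q1 q2 q3 q4 [q5 q6]]; split.
- exact: lin_comp.
- exact: lin_comp.
- by move=> a /=; rewrite q3 p3.
- by move=> x y /=; rewrite q4 p4.
- by split=> [x a|a x] /=; rewrite ?q5 ?p5 ?q6 ?p6.
Qed.

Definition xaut_mul (F G : xaut A) : xaut A :=
  XAut (xhom_comp (aut_hom F) (aut_hom G))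
    (bij_comp (aut_bij0 F) (aut_bij0 G)) (bij_comp (aut_bij1 F) (aut_bij1 G)).

Definition bij_inv (T U : Type) (f : T -> U) (h : bijective f) : U -> T :=
  sval (cid (let: Bijective g fK gK := h in
    ex_intro (fun g => cancel f g /\ cancel g f) g (conj fK gK))).

Lemma bij_invK (T U : Type) (f : T -> U) (h : bijective f) :
  cancel f (bij_inv h).
Proof. by rewrite /bij_inv; case: cid => ? []. Qed.

Lemma bij_invVK (T U : Type) (f : T -> U) (h : bijective f) :
  cancel (bij_inv h) f.
Proof. by rewrite /bij_inv; case: cid => ? []. Qed.

Lemma bij_inv_bij (T U : Type) (f : T -> U) (h : bijective f) :
  bijective (bij_inv h).
Proof. by exists f; [exact: bij_invVK | exact: bij_invK]. Qed.

Lemma xhom_inv (F : xaut A) :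
  xhom_axiom (bij_inv (aut_bij0 F)) (bij_inv (aut_bij1 F)).
Proof.
have [p1 p2 p3 p4 [p5 p6]] := aut_hom F.
have K0 := bij_invK (aut_bij0 F); have V0 := bij_invVK (aut_bij0 F).
have K1 := bij_invK (aut_bij1 F); have V1 := bij_invVK (aut_bij1 F).
split.
- exact: lin_inv p1 K0 V0.
- exact: lin_inv p2 K1 V1.
- by move=> a; apply: (can_inj K0); rewrite V0 p3 V1.
- by move=> x y; apply: (can_inj K0); rewrite p4 !V0.
- by split=> [x a|a x]; apply: (can_inj K1); rewrite ?p5 ?p6 !V1 V0.
Qed.

Definition xaut_inv (F : xaut A) : xaut A :=
  XAut (xhom_inv F) (bij_inv_bij (aut_bij0 F)) (bij_inv_bij (aut_bij1 F)).

Lemma xaut_mulA : associative xaut_mul.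
Proof. by move=> F G H; apply: xaut_ext. Qed.

Lemma xaut_mul1 : left_id xaut_one xaut_mul.
Proof. by move=> F; apply: xaut_ext. Qed.

Lemma xaut_mulr1 : right_id xaut_one xaut_mul.
Proof. by move=> F; apply: xaut_ext. Qed.

Lemma xaut_mulV : left_inverse xaut_one xaut_inv xaut_mul.
Proof. by move=> F; apply: xaut_ext => x /=; rewrite bij_invK. Qed.

Lemma xaut_mulrV : right_inverse xaut_one xaut_inv xaut_mul.
Proof. by move=> F; apply: xaut_ext => x /=; rewrite bij_invVK. Qed.

HB.instance Definition _ := isGroup.Build (xaut A)
  xaut_mulA xaut_mul1 xaut_mulr1 xaut_mulV xaut_mulrV.

Lemma aut0M (F G : xaut A) x : aut0 (F * G)%g x = aut0 F (aut0 G x).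
Proof. by []. Qed.

Lemma aut1M (F G : xaut A) x : aut1 (F * G)%g x = aut1 F (aut1 G x).
Proof. by []. Qed.

Lemma aut0K (F : xaut A) : cancel (aut0 F) (aut0 F^-1%g).
Proof. exact: bij_invK. Qed.

Lemma aut0VK (F : xaut A) : cancel (aut0 F^-1%g) (aut0 F).
Proof. exact: bij_invVK. Qed.

Lemma aut1K (F : xaut A) : cancel (aut1 F) (aut1 F^-1%g).
Proof. exact: bij_invK. Qed.

Lemma aut1VK (F : xaut A) : cancel (aut1 F^-1%g) (aut1 F).
Proof. exact: bij_invVK. Qed.

End AutGroup.

Section Induced.
Variables (V P : xmod) (E : abelian_extension V P) (s : section E).

Local Notation i0 := (@inc0 V P E).
Local Notation i1 := (@inc1 V P E).
Local Notation p0 := (@prj0 V P E).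
Local Notation p1 := (@prj1 V P E).
Local Notation s0 := (@sec0 V P E s).
Local Notation s1 := (@sec1 V P E s).

(* Inverses of the inclusions on their images (junk value elsewhere). *)
Definition uninc0 (e : deg0 (mid E)) : deg0 V := xget 0 [set v | i0 v = e].
Definition uninc1 (e : deg1 (mid E)) : deg1 V := xget 0 [set v | i1 v = e].

Definition induced_rep : actions V P := {|
  l00 := fun x w => uninc0 (brk (s0 x) (i0 w));
  l01 := fun x m => uninc1 (lact (s0 x) (i1 m));
  r00 := fun x w => uninc0 (brk (i0 w) (s0 x));
  r01 := fun x m => uninc1 (ract (i1 m) (s0 x));
  l1 := fun a w => uninc1 (ract (s1 a) (i0 w));
  r1 := fun a w => uninc1 (lact (i0 w) (s1 a)) |}.

Definition induced_cocycle : cochain2 V P :=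
  (fun a => uninc0 (bdry (s1 a) - s0 (bdry a)),
   fun x y => uninc0 (brk (s0 x) (s0 y) - s0 (brk x y)),
   fun x a => uninc1 (lact (s0 x) (s1 a) - s1 (lact x a)),
   fun a x => uninc1 (ract (s1 a) (s0 x) - s1 (ract a x))).

Local Notation rho := induced_rep.
Local Notation cE := induced_cocycle.

Lemma inc0_lin : linear i0. Proof. by have [] := inc_hom E. Qed.
Lemma inc1_lin : linear i1. Proof. by have [] := inc_hom E. Qed.
Lemma prj0_lin : linear p0. Proof. by have [] := prj_hom E. Qed.
Lemma prj1_lin : linear p1. Proof. by have [] := prj_hom E. Qed.

Lemma prj0_inc v : p0 (i0 v) = 0.
Proof. by apply/ext_exact0; exists v. Qed.

Lemma prj1_inc m : p1 (i1 m) = 0.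
Proof. by apply/ext_exact1; exists m. Qed.

Lemma uninc0K e : p0 e = 0 -> i0 (uninc0 e) = e.
Proof. by move=> /ext_exact0 [v hv]; rewrite /uninc0; case: xgetP => [w -> //|/(_ v)]. Qed.

Lemma uninc1K e : p1 e = 0 -> i1 (uninc1 e) = e.
Proof. by move=> /ext_exact1 [v hv]; rewrite /uninc1; case: xgetP => [w -> //|/(_ v)]. Qed.

Lemma inc0K : cancel i0 uninc0.
Proof. by move=> v; apply: (@inc0_inj _ _ E); rewrite uninc0K // prj0_inc. Qed.

Lemma inc1K : cancel i1 uninc1.
Proof. by move=> v; apply: (@inc1_inj _ _ E); rewrite uninc1K // prj1_inc. Qed.

Lemma dec0 e : exists v, e = s0 (p0 e) + i0 v.
Proof.
exists (uninc0 (e - s0 (p0 e))); rewrite uninc0K ?subrKC //.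
by rewrite (linB prj0_lin) sec0K subrr.
Qed.

Lemma dec1 e : exists v, e = s1 (p1 e) + i1 v.
Proof.
exists (uninc1 (e - s1 (p1 e))); rewrite uninc1K ?subrKC //.
by rewrite (linB prj1_lin) sec1K subrr.
Qed.

Lemma prj_bdry a : p0 (bdry a) = bdry (p1 a).
Proof. by have [] := prj_hom E. Qed.

Lemma prj_brk x y : p0 (brk x y) = brk (p0 x) (p0 y).
Proof. by have [] := prj_hom E. Qed.

Lemma prj_lact x a : p1 (lact x a) = lact (p0 x) (p1 a).
Proof. by have [_ _ _ _ []] := prj_hom E. Qed.

Lemma prj_ract x a : p1 (ract a x) = ract (p1 a) (p0 x).
Proof. by have [_ _ _ _ []] := prj_hom E. Qed.

Lemma inc_bdry a : i0 (bdry a) = bdry (i1 a).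
Proof. by have [] := inc_hom E. Qed.

Lemma brk_inc_inc u v : brk (i0 u) (i0 v) = 0.
Proof.
have [_ _ _ h _] := inc_hom E; have [h' _ _] := abextP E.
by rewrite -h h' (lin0 inc0_lin).
Qed.

Lemma lact_inc_inc u m : lact (i0 u) (i1 m) = 0.
Proof.
have [_ _ _ _ [h _]] := inc_hom E; have [_ h' _] := abextP E.
by rewrite -h h' (lin0 inc1_lin).
Qed.

Lemma ract_inc_inc m u : ract (i1 m) (i0 u) = 0.
Proof.
have [_ _ _ _ [_ h]] := inc_hom E; have [_ _ h'] := abextP E.
by rewrite -h h' (lin0 inc1_lin).
Qed.

Lemma inc_l00 e w : i0 (l00 rho (p0 e) w) = brk e (i0 w).
Proof.
rewrite uninc0K; last by rewrite prj_brk prj0_inc (bil0r (@brk_bil _)).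
have [v {2}->] := dec0 e.
by rewrite (bilDl (@brk_bil _)) brk_inc_inc addr0.
Qed.

Lemma inc_r00 e w : i0 (r00 rho (p0 e) w) = brk (i0 w) e.
Proof.
rewrite uninc0K; last by rewrite prj_brk prj0_inc (bil0l (@brk_bil _)).
have [v {2}->] := dec0 e.
by rewrite (bilDr (@brk_bil _)) brk_inc_inc addr0.
Qed.

Lemma inc_l01 e m : i1 (l01 rho (p0 e) m) = lact e (i1 m).
Proof.
rewrite uninc1K; last by rewrite prj_lact prj1_inc (bil0r (@lact_bil _)).
have [v {2}->] := dec0 e.
by rewrite (bilDl (@lact_bil _)) lact_inc_inc addr0.
Qed.

Lemma inc_r01 e m : i1 (r01 rho (p0 e) m) = ract (i1 m) e.
Proof.
rewrite uninc1K; last by rewrite prj_ract prj1_inc (bil0l (@ract_bil _)).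
have [v {2}->] := dec0 e.
by rewrite (bilDr (@ract_bil _)) ract_inc_inc addr0.
Qed.

Lemma inc_l1 e w : i1 (l1 rho (p1 e) w) = ract e (i0 w).
Proof.
rewrite uninc1K; last by rewrite prj_ract prj0_inc (bil0r (@ract_bil _)).
have [v {2}->] := dec1 e.
by rewrite (bilDl (@ract_bil _)) ract_inc_inc addr0.
Qed.

Lemma inc_r1 e w : i1 (r1 rho (p1 e) w) = lact (i0 w) e.
Proof.
rewrite uninc1K; last by rewrite prj_lact prj0_inc (bil0l (@lact_bil _)).
have [v {2}->] := dec1 e.
by rewrite (bilDr (@lact_bil _)) lact_inc_inc addr0.
Qed.

Lemma sec_l00 x w : i0 (l00 rho x w) = brk (s0 x) (i0 w).
Proof. by rewrite -inc_l00 sec0K. Qed.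

Lemma sec_r00 x w : i0 (r00 rho x w) = brk (i0 w) (s0 x).
Proof. by rewrite -inc_r00 sec0K. Qed.

Lemma sec_l01 x w : i1 (l01 rho x w) = lact (s0 x) (i1 w).
Proof. by rewrite -inc_l01 sec0K. Qed.

Lemma sec_r01 x w : i1 (r01 rho x w) = ract (i1 w) (s0 x).
Proof. by rewrite -inc_r01 sec0K. Qed.

Lemma sec_l1 x w : i1 (l1 rho x w) = ract (s1 x) (i0 w).
Proof. by rewrite -inc_l1 sec1K. Qed.

Lemma sec_r1 x w : i1 (r1 rho x w) = lact (i0 w) (s1 x).
Proof. by rewrite -inc_r1 sec1K. Qed.

Lemma inc_theta a : bdry (s1 a) = s0 (bdry a) + i0 (theta cE a).
Proof.
by rewrite uninc0K ?subrKC // (linB prj0_lin) sec0K prj_bdry sec1K subrr.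
Qed.

Lemma inc_omega x y : brk (s0 x) (s0 y) = s0 (brk x y) + i0 (omega cE x y).
Proof.
by rewrite uninc0K ?subrKC // (linB prj0_lin) prj_brk !sec0K subrr.
Qed.

Lemma inc_mu x a : lact (s0 x) (s1 a) = s1 (lact x a) + i1 (mu cE x a).
Proof.
by rewrite uninc1K ?subrKC // (linB prj1_lin) prj_lact !sec1K !sec0K subrr.
Qed.

Lemma inc_nu a x : ract (s1 a) (s0 x) = s1 (ract a x) + i1 (nu cE a x).
Proof.
by rewrite uninc1K ?subrKC // (linB prj1_lin) prj_ract !sec1K !sec0K subrr.
Qed.

Local Opaque induced_rep induced_cocycle.

Lemma l00_bil : bilin (l00 rho).
Proof.
apply: bilinP => [w k x y|x k u v]; apply: (@inc0_inj _ _ E).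
  by rewrite inc0_lin !sec_l00 sec0_lin (brk_bil _).1.
by rewrite inc0_lin !sec_l00 inc0_lin (brk_bil _).2.
Qed.

Lemma r00_bil : bilin (r00 rho).
Proof.
apply: bilinP => [w k x y|x k u v]; apply: (@inc0_inj _ _ E).
  by rewrite inc0_lin !sec_r00 sec0_lin (brk_bil _).2.
by rewrite inc0_lin !sec_r00 inc0_lin (brk_bil _).1.
Qed.

Lemma l01_bil : bilin (l01 rho).
Proof.
apply: bilinP => [w k x y|x k u v]; apply: (@inc1_inj _ _ E).
  by rewrite inc1_lin !sec_l01 sec0_lin (lact_bil _).1.
by rewrite inc1_lin !sec_l01 inc1_lin (lact_bil _).2.
Qed.

Lemma r01_bil : bilin (r01 rho).
Proof.
apply: bilinP => [w k x y|x k u v]; apply: (@inc1_inj _ _ E).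
  by rewrite inc1_lin !sec_r01 sec0_lin (ract_bil _).2.
by rewrite inc1_lin !sec_r01 inc1_lin (ract_bil _).1.
Qed.

Lemma l1_bil : bilin (l1 rho).
Proof.
apply: bilinP => [w k x y|x k u v]; apply: (@inc1_inj _ _ E).
  by rewrite inc1_lin !sec_l1 sec1_lin (ract_bil _).1.
by rewrite inc1_lin !sec_l1 inc0_lin (ract_bil _).2.
Qed.

Lemma r1_bil : bilin (r1 rho).
Proof.
apply: bilinP => [w k x y|x k u v]; apply: (@inc1_inj _ _ E).
  by rewrite inc1_lin !sec_r1 sec1_lin (lact_bil _).2.
by rewrite inc1_lin !sec_r1 inc0_lin (lact_bil _).1.
Qed.

Lemma cocycle2_tw c : tw_xmod rho c -> cocycle2 rho c.
Proof.
move=> h; split=> //; case: h => [[b _] [l r _ _ _] f _].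
- move=> k x y; have := congr1 snd (f k (x, 0) (y, 0)).
  by rewrite /= scaler0 !addr0 (lin0 (@bdry_lin _)) !addr0.
- apply: bilinP => [z k x y|x k y z].
    have := congr1 snd (b.1 (z, 0) k (x, 0) (y, 0)).
    by rewrite /= scaler0 !addr0 ?(bil0r l00_bil) ?(bil0r r00_bil) !addr0.
  have := congr1 snd (b.2 (x, 0) k (y, 0) (z, 0)).
  by rewrite /= scaler0 !addr0 ?(bil0r l00_bil) ?(bil0r r00_bil) !addr0.
- apply: bilinP => [z k x y|x k y z].
    have := congr1 snd (l.1 (z, 0) k (x, 0) (y, 0)).
    by rewrite /= scaler0 !addr0 ?(bil0r l01_bil) ?(bil0r r1_bil) !addr0.
  have := congr1 snd (l.2 (x, 0) k (y, 0) (z, 0)).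
  by rewrite /= scaler0 !addr0 ?(bil0r l01_bil) ?(bil0r r1_bil) !addr0.
- apply: bilinP => [z k x y|x k y z].
    have := congr1 snd (r.1 (z, 0) k (x, 0) (y, 0)).
    by rewrite /= scaler0 !addr0 ?(bil0r l1_bil) ?(bil0r r01_bil) !addr0.
  have := congr1 snd (r.2 (x, 0) k (y, 0) (z, 0)).
  by rewrite /= scaler0 !addr0 ?(bil0r l1_bil) ?(bil0r r01_bil) !addr0.
Qed.

Lemma dec0_inj x u y v : s0 x + i0 u = s0 y + i0 v -> (x, u) = (y, v).
Proof.
move=> e; have exy : x = y.
  have := congr1 p0 e.
  by rewrite !(linD prj0_lin) !prj0_inc !addr0 !sec0K.
by move: e; rewrite exy => /addrI /inc0_inj ->.
Qed.

Lemma dec1_inj x u y v : s1 x + i1 u = s1 y + i1 v -> (x, u) = (y, v).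
Proof.
move=> e; have exy : x = y.
  have := congr1 p1 e.
  by rewrite !(linD prj1_lin) !prj1_inc !addr0 !sec1K.
by move: e; rewrite exy => /addrI /inc1_inj ->.
Qed.

Lemma induced_cocycleP : cocycle2 rho cE.
Proof.
apply: cocycle2_tw.
apply: (xmod_transfer (R0 := fun e w => e = s0 w.1 + i0 w.2)
  (R1 := fun e w => e = s1 w.1 + i1 w.2) (xmodP (mid E))).
- by move=> b; eexists.
- by move=> b; eexists.
- by move=> a [x u] [y v] /= -> /dec0_inj.
- by move=> a [x u] [y v] /= -> /dec1_inj.
- move=> k a a' b b' -> -> /=.
  by rewrite sec0_lin inc0_lin scalerDr addrACA.
- move=> k a a' b b' -> -> /=.
  by rewrite sec1_lin inc1_lin scalerDr addrACA.
- move=> _ [a m] -> /=.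
  by rewrite (linD (@bdry_lin _)) inc_theta -inc_bdry -addrA (linD inc0_lin).
- move=> _ [x u] _ [y v] -> -> /=.
  rewrite (bilDl (@brk_bil _)) !(bilDr (@brk_bil _)) inc_omega brk_inc_inc addr0.
  rewrite !(linD inc0_lin) sec_l00 sec_r00.
  by rewrite !addrA.
- move=> _ [x u] _ [y v] -> -> /=.
  rewrite (bilDl (@lact_bil _)) !(bilDr (@lact_bil _)) inc_mu lact_inc_inc addr0.
  rewrite !(linD inc1_lin) sec_l01 sec_r1.
  by rewrite !addrA.
- move=> _ [x u] _ [y v] -> -> /=.
  rewrite (bilDl (@ract_bil _)) !(bilDr (@ract_bil _)) inc_nu ract_inc_inc addr0.
  rewrite !(linD inc1_lin) sec_l1 sec_r01.
  by rewrite !addrA.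
Qed.

Lemma cocycle2_0 : cocycle2 rho 0.
Proof.
apply: cocycle2_tw.
apply: (xmod_transfer
  (R0 := fun e w => e.1 = e.2 + i0 w.2 /\ p0 e.2 = w.1)
  (R1 := fun e w => e.1 = e.2 + i1 w.2 /\ p1 e.2 = w.1)
  (xmod_prod (xmodP (mid E)) (xmodP (mid E)))).
- by move=> [x u]; exists (s0 x + i0 u, s0 x); rewrite /= sec0K.
- by move=> [x u]; exists (s1 x + i1 u, s1 x); rewrite /= sec1K.
- by move=> [e e'] [x u] [y v] /= [-> ->] [/addrI /inc0_inj -> ->].
- by move=> [e e'] [x u] [y v] /= [-> ->] [/addrI /inc1_inj -> ->].
- move=> k [a1 a2] [a1' a2'] [b1 b2] [b1' b2'] /= [-> <-] [-> <-].
  by rewrite inc0_lin prj0_lin scalerDr addrACA.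
- move=> k [a1 a2] [a1' a2'] [b1 b2] [b1' b2'] /= [-> <-] [-> <-].
  by rewrite inc1_lin prj1_lin scalerDr addrACA.
- move=> [e1 e2] [a m] /= [-> <-]; rewrite prj_bdry; split=> //.
  by rewrite add0r inc_bdry (linD (@bdry_lin _)).
- move=> [e1 e2] [x u] [e1' e2'] [y v] /= [-> <-] [-> <-].
  rewrite prj_brk; split=> //.
  rewrite (bilDl (@brk_bil _)) !(bilDr (@brk_bil _)) brk_inc_inc addr0.
  by rewrite add0r !(linD inc0_lin) inc_l00 inc_r00 !addrA.
- move=> [e1 e2] [x u] [e1' e2'] [y v] /= [-> <-] [-> <-].
  rewrite prj_lact; split=> //.
  rewrite (bilDl (@lact_bil _)) !(bilDr (@lact_bil _)) lact_inc_inc addr0.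
  by rewrite add0r !(linD inc1_lin) inc_l01 inc_r1 !addrA.
- move=> [e1 e2] [x u] [e1' e2'] [y v] /= [-> <-] [-> <-].
  rewrite prj_ract; split=> //.
  rewrite (bilDl (@ract_bil _)) !(bilDr (@ract_bil _)) ract_inc_inc addr0.
  by rewrite add0r !(linD inc1_lin) inc_l1 inc_r01 !addrA.
Qed.

Lemma cocycle2B c c' :
  cocycle2 rho c -> cocycle2 rho c' -> cocycle2 rho (c - c').
Proof.
move=> [_ _ _ _ h] [_ _ _ _ h']; have [_ _ _ _ h0] := cocycle2_0.
apply: cocycle2_tw.
apply: (xmod_transfer
  (R0 := fun e w => [/\ e.1.1.1 = w.1, e.1.2.1 = w.1, e.2.1 = w.1
    & w.2 = e.1.1.2 - e.1.2.2 + e.2.2])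
  (R1 := fun e w => [/\ e.1.1.1 = w.1, e.1.2.1 = w.1, e.2.1 = w.1
    & w.2 = e.1.1.2 - e.1.2.2 + e.2.2]) (xmod_prod (xmod_prod h h') h0)).
- by move=> [x u]; exists (((x, u), (x, 0)), (x, 0)); rewrite /= subr0 addr0.
- by move=> [x u]; exists (((x, u), (x, 0)), (x, 0)); rewrite /= subr0 addr0.
- by move=> e [x u] [y v] /= [-> _ _ ->] [-> _ _ ->].
- by move=> e [x u] [y v] /= [-> _ _ ->] [-> _ _ ->].
- move=> k [[[x u] [x' v]] [x2 w]] [[[y u'] [y' v']] [y2 w']] [z t] [z' t'] /=.
  move=> [-> -> -> ->] [-> -> -> ->]; split=> //.
  rewrite !scalerDr !opprD scalerN.
  by rewrite [LHS](AC (3*3)%AC ((1*4)*(2*5)*(3*6))%AC).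
- move=> k [[[x u] [x' v]] [x2 w]] [[[y u'] [y' v']] [y2 w']] [z t] [z' t'] /=.
  move=> [-> -> -> ->] [-> -> -> ->]; split=> //.
  rewrite !scalerDr !opprD scalerN.
  by rewrite [LHS](AC (3*3)%AC ((1*4)*(2*5)*(3*6))%AC).
- move=> [[[x u] [x' v]] [x2 w]] [z t] /= [-> -> -> ->]; split=> //.
  rewrite (linD (@bdry_lin _)) (linB (@bdry_lin _)) add0r opprD.
  by rewrite [LHS](AC (2*3)%AC ((1*3)*(2*4)*5)%AC).
- move=> [[[x u] [x' v]] [x2 w]] [z t] [[[y u'] [y' v']] [y2 w']] [z' t'] /=.
  move=> [-> -> -> ->] [-> -> -> ->]; split=> //.
  rewrite (bilDr l00_bil) (bilBr l00_bil) (bilDr r00_bil) (bilBr r00_bil).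
  exact: rearr.
- move=> [[[x u] [x' v]] [x2 w]] [z t] [[[y u'] [y' v']] [y2 w']] [z' t'] /=.
  move=> [-> -> -> ->] [-> -> -> ->]; split=> //.
  rewrite (bilDr l01_bil) (bilBr l01_bil) (bilDr r1_bil) (bilBr r1_bil).
  exact: rearr.
- move=> [[[x u] [x' v]] [x2 w]] [z t] [[[y u'] [y' v']] [y2 w']] [z' t'] /=.
  move=> [-> -> -> ->] [-> -> -> ->]; split=> //.
  rewrite (bilDr l1_bil) (bilBr l1_bil) (bilDr r01_bil) (bilBr r01_bil).
  exact: rearr.
Qed.

Lemma coboundaryP (l : cochain1 V P) :
  linear l.1 -> linear l.2 -> cocycle2 rho (coboundary rho l).
Proof.
case: l => [a b] /= ha hb; have [_ _ _ _ h0] := cocycle2_0.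
apply: cocycle2_tw.
apply: (xmod_transfer
  (R0 := fun e w => w = (e.1, e.2 - a e.1))
  (R1 := fun e w => w = (e.1, e.2 - b e.1)) h0).
- by move=> [x u]; exists (x, u + a x); rewrite /= addrK.
- by move=> [x u]; exists (x, u + b x); rewrite /= addrK.
- by move=> [x u] ? ? -> ->.
- by move=> [x u] ? ? -> ->.
- move=> k [x u] [y v] _ _ -> ->; apply: injective_projections => //=.
  by rewrite ha opprD scalerBr addrACA.
- move=> k [x u] [y v] _ _ -> ->; apply: injective_projections => //=.
  by rewrite hb opprD scalerBr addrACA.
- move=> [x u] _ ->; apply: injective_projections => //=.
  by rewrite /theta /= add0r (linB (@bdry_lin _)) addrC addrA subrK.
- move=> [x u] _ [y v] _ -> ->; apply: injective_projections => //=.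
  rewrite /omega /= (bilBr l00_bil) (bilBr r00_bil) add0r.
  exact: subr_cancel2.
- move=> [x u] _ [y v] _ -> ->; apply: injective_projections => //=.
  rewrite /mu /= (bilBr l01_bil) (bilBr r1_bil) add0r.
  exact: subr_cancel2.
- move=> [x u] _ [y v] _ -> ->; apply: injective_projections => //=.
  rewrite /nu /= (bilBr l1_bil) (bilBr r01_bil) add0r.
  exact: subr_cancel2.
Qed.

Lemma coboundaryB (l m : cochain1 V P) :
  coboundary rho (l - m) = coboundary rho l - coboundary rho m.
Proof.
case: l m => [l0 l1] [m0 m1]; congr (_, _, _, _).
- apply: funext => a; rewrite /= (linB (@bdry_lin _)).
  by rewrite !opprD !opprK addrACA.
- apply: funext => x; apply: funext => y; rewrite /=.
  by rewrite (bilBr l00_bil) (bilBr r00_bil) subrACA.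
- apply: funext => x; apply: funext => y; rewrite /=.
  by rewrite (bilBr l01_bil) (bilBr r1_bil) subrACA.
- apply: funext => x; apply: funext => y; rewrite /=.
  by rewrite (bilBr l1_bil) (bilBr r01_bil) subrACA.
Qed.

Lemma coboundary0 : coboundary rho 0 = 0.
Proof. by rewrite -(subrr 0) coboundaryB subrr. Qed.

Definition Z1_pred : {pred cochain1 V P} := fun l => `[< cocycle1 rho l >].

Lemma Z1_closed : zmod_closed Z1_pred.
Proof.
split=> [|l m /asboolP [h1 h2 h3] /asboolP [h4 h5 h6]]; apply/asboolP.
  by split; [exact: linear0 | exact: linear0 | exact: coboundary0].
split; [exact: linearB_fct | exact: linearB_fct |].
by rewrite coboundaryB h3 h6 subrr.
Qed.

HB.instance Definition _ :=
  GRing.isZmodClosed.Build (cochain1 V P) Z1_pred Z1_closed.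

Record Z1 := MkZ1 { z1val :> cochain1 V P; _ : z1val \in Z1_pred }.
HB.instance Definition _ := [isSub for z1val].
HB.instance Definition _ := [Choice of Z1 by <:].
HB.instance Definition _ := [SubChoice_isSubZmodule of Z1 by <:].

Definition Z2_pred : {pred cochain2 V P} := fun c => `[< cocycle2 rho c >].

Lemma Z2_closed : zmod_closed Z2_pred.
Proof.
split=> [|l m /asboolP h1 /asboolP h2]; apply/asboolP.
  exact: cocycle2_0.
exact: cocycle2B.
Qed.

HB.instance Definition _ :=
  GRing.isZmodClosed.Build (cochain2 V P) Z2_pred Z2_closed.

Record Z2 := MkZ2 { z2val :> cochain2 V P; _ : z2val \in Z2_pred }.
HB.instance Definition _ := [isSub for z2val].
HB.instance Definition _ := [Choice of Z2 by <:].
HB.instance Definition _ := [SubChoice_isSubZmodule of Z2 by <:].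

Definition mkZ2 (c : cochain2 V P) (hc : cocycle2 rho c) : Z2 :=
  MkZ2 (introT (asboolP _) hc).

(* By coboundaryP every coboundary lies in Z2, so this is the set of all
   coboundaries, seen in Z2. *)
Definition B2 : {pred Z2} := fun z =>
  `[< exists l : cochain1 V P,
      [/\ linear l.1, linear l.2 & z2val z = coboundary rho l] >].

Lemma B2_closed : zmod_closed B2.
Proof.
split=> [|z z' /asboolP [l [h1 h2 h3]] /asboolP [m [h4 h5 h6]]]; apply/asboolP.
  exists 0; split; [exact: linear0 | exact: linear0 |].
  by rewrite coboundary0.
exists (l - m); split; [exact: linearB_fct | exact: linearB_fct |].
by rewrite coboundaryB -h3 -h6.
Qed.

HB.instance Definition _ := GRing.isZmodClosed.Build Z2 B2 B2_closed.

Definition H2 := Quotient.quot B2.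

(* An inverse-free form of compatible, see compatibleE. *)
Definition intertwine (b : xaut V) (a : xaut P) : Prop :=
  [/\ forall x w, aut0 b (l00 rho x w) = l00 rho (aut0 a x) (aut0 b w),
      forall x w, aut0 b (r00 rho x w) = r00 rho (aut0 a x) (aut0 b w),
      forall x m, aut1 b (l01 rho x m) = l01 rho (aut0 a x) (aut1 b m),
      forall x m, aut1 b (r01 rho x m) = r01 rho (aut0 a x) (aut1 b m)
    & (forall e w, aut1 b (r1 rho e w) = r1 rho (aut1 a e) (aut0 b w)) /\
      (forall e w, aut1 b (l1 rho e w) = l1 rho (aut1 a e) (aut0 b w))].

Definition compatible (b : xaut V) (a : xaut P) : Prop :=
  [/\ forall x w, aut0 b (l00 rho x (aut0 b^-1%g w)) = l00 rho (aut0 a x) w,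
      forall x w, aut0 b (r00 rho x (aut0 b^-1%g w)) = r00 rho (aut0 a x) w,
      forall x m, aut1 b (l01 rho x (aut1 b^-1%g m)) = l01 rho (aut0 a x) m,
      forall x m, aut1 b (r01 rho x (aut1 b^-1%g m)) = r01 rho (aut0 a x) m
    & (forall e w, aut1 b (r1 rho e (aut0 b^-1%g w)) = r1 rho (aut1 a e) w) /\
      (forall e w, aut1 b (l1 rho e (aut0 b^-1%g w)) = l1 rho (aut1 a e) w)].

Lemma compatibleE b a : compatible b a <-> intertwine b a.
Proof.
split=> [] [h1 h2 h3 h4 [h5 h6]]; split.
- by move=> x w; rewrite -h1 aut0K.
- by move=> x w; rewrite -h2 aut0K.
- by move=> x w; rewrite -h3 aut1K.
- by move=> x w; rewrite -h4 aut1K.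
- by split=> x w; rewrite -?h5 -?h6 aut0K.
- by move=> x w; rewrite h1 aut0VK.
- by move=> x w; rewrite h2 aut0VK.
- by move=> x w; rewrite h3 aut1VK.
- by move=> x w; rewrite h4 aut1VK.
- by split=> x w; rewrite ?h5 ?h6 aut0VK.
Qed.

Definition Crho_pred : {pred (xaut V * xaut P)%type} :=
  fun ba => `[< compatible ba.1 ba.2 >].

Lemma Crho_closed : group_closed Crho_pred.
Proof.
split=> [|[b a] [b' a'] /asboolP /compatibleE h /asboolP /compatibleE h'];
  apply/asboolP/compatibleE => //.
have {h'} [k1 k2 k3 k4 [k5 k6]] : intertwine b'^-1%g a'^-1%g.
  have [h1 h2 h3 h4 [h5 h6]] := h'; split.
  - by move=> x w; apply: (can_inj (aut0K b')); rewrite h1 !aut0VK.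
  - by move=> x w; apply: (can_inj (aut0K b')); rewrite h2 !aut0VK.
  - by move=> x w; apply: (can_inj (aut1K b')); rewrite h3 aut0VK !aut1VK.
  - by move=> x w; apply: (can_inj (aut1K b')); rewrite h4 aut0VK !aut1VK.
  - by split=> x w; apply: (can_inj (aut1K b'));
      rewrite ?h5 ?h6 aut0VK !aut1VK.
have [h1 h2 h3 h4 [h5 h6]] := h.
split=> [x w|x w|x w|x w|]; rewrite ?aut0M ?aut1M.
- by rewrite k1 h1.
- by rewrite k2 h2.
- by rewrite k3 h3.
- by rewrite k4 h4.
- by split=> x w; rewrite !aut0M !aut1M ?k5 ?k6 ?h5 ?h6.
Qed.

Record Crho := MkCrho {
  crho_val :> (xaut V * xaut P)%type;
  _ : crho_val \in Crho_pred
}.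
HB.instance Definition _ := [isSub for crho_val].
HB.instance Definition _ := [Choice of Crho by <:].
HB.instance Definition _ :=
  SubChoice_isSubGroup.Build (xaut V * xaut P)%type Crho_pred Crho Crho_closed.

Lemma crhoP (c : Crho) : intertwine c.1 c.2.
Proof. by case: c => c /= /asboolP /compatibleE. Qed.

Definition twist (b : xaut V) (a : xaut P) (c : cochain2 V P) : cochain2 V P :=
  (fun e => aut0 b (theta c (aut1 a^-1%g e)),
   fun x y => aut0 b (omega c (aut0 a^-1%g x) (aut0 a^-1%g y)),
   fun x e => aut1 b (mu c (aut0 a^-1%g x) (aut1 a^-1%g e)),
   fun e x => aut1 b (nu c (aut1 a^-1%g e) (aut0 a^-1%g x))).

Lemma twistP b a c :
  intertwine b a -> cocycle2 rho c -> cocycle2 rho (twist b a c).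
Proof.
move=> [k1 k2 k3 k4 [k5 k6]] [_ _ _ _ h]; apply: cocycle2_tw.
move: (aut0VK b) (aut1VK b); move: (b^-1)%g => bi W0 W1.
move: (aut0K a) (aut0VK a) (aut1K a) (aut1VK a); rewrite /twist.
move: (a^-1)%g => ai K0 V0 K1 V1.
have [b1 b2 b3 b4 [b5 b6]] := aut_hom b.
have [a1 a2 a3 a4 [a5 a6]] := aut_hom a.
apply: (xmod_transfer
  (R0 := fun e w => w = (aut0 a e.1, aut0 b e.2))
  (R1 := fun e w => w = (aut1 a e.1, aut1 b e.2)) h).
- move=> [x u]; exists (aut0 ai x, aut0 bi u).
  by rewrite /= V0 W0.
- move=> [x u]; exists (aut1 ai x, aut1 bi u).
  by rewrite /= V1 W1.
- by move=> [x u] ? ? -> ->.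
- by move=> [x u] ? ? -> ->.
- move=> k [x u] [y v] _ _ -> ->; by apply: injective_projections; rewrite /= ?a1 ?b1.
- move=> k [x u] [y v] _ _ -> ->; by apply: injective_projections; rewrite /= ?a2 ?b2.
- move=> [x u] _ ->; rewrite /tw_bdry /theta /=.
  by rewrite a3 K1 (linD b1) b3.
- move=> [x u] _ [y v] _ -> ->; rewrite /tw_brk /omega /=.
  by rewrite a4 !K0 !(linD b1) k1 k2.
- move=> [x u] _ [y v] _ -> ->; rewrite /tw_lact /mu /=.
  by rewrite a5 K0 K1 !(linD b2) k3 k5.
- move=> [x u] _ [y v] _ -> ->; rewrite /tw_ract /nu /=.
  by rewrite a6 K0 K1 !(linD b2) k4 k6.
Qed.

Definition wells (c : Crho) : H2 :=
  \pi_H2 (mkZ2 (twistP (crhoP c) induced_cocycleP))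
  - \pi_H2 (mkZ2 induced_cocycleP).

Definition autV_pred : {pred xaut (mid E)} := fun F =>
  `[< aut0 F @` range i0 = range i0 /\ aut1 F @` range i1 = range i1 >].

Lemma image_inv (T : Type) (f g : T -> T) (A : set T) :
  cancel f g -> f @` A = A -> g @` A = A.
Proof.
by move=> fK h; rewrite -[in LHS]h image_comp eq_image_id // => x _; apply: fK.
Qed.

Lemma autV_closed : group_closed autV_pred.
Proof.
split=> [|F G /asboolP [h0 h1] /asboolP [h2 h3]]; apply/asboolP.
  by split; rewrite image_id.
have k0 := image_inv (aut0K G) h2; have k1 := image_inv (aut1K G) h3.
split.
  by rewrite (_ : aut0 _ = aut0 F \o aut0 G^-1%g) // -image_comp k0.
by rewrite (_ : aut1 _ = aut1 F \o aut1 G^-1%g) // -image_comp k1.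
Qed.

Record AutV := MkAutV {
  autV_val :> xaut (mid E);
  _ : autV_val \in autV_pred
}.
HB.instance Definition _ := [isSub for autV_val].
HB.instance Definition _ := [Choice of AutV by <:].
HB.instance Definition _ :=
  SubChoice_isSubGroup.Build (xaut (mid E)) autV_pred AutV autV_closed.

Lemma autV_P (F : AutV) :
  aut0 F @` range i0 = range i0 /\ aut1 F @` range i1 = range i1.
Proof. by case: F => F /= /asboolP. Qed.

(* For e = sigma0 x + v one has x = p0 e and v = e - sigma0 (p0 e). *)
Definition Flam0 (l : cochain1 V P) (e : deg0 (mid E)) : deg0 (mid E) :=
  s0 (p0 e) + i0 (l.1 (p0 e)) + (e - s0 (p0 e)).

Definition Flam1 (l : cochain1 V P) (e : deg1 (mid E)) : deg1 (mid E) :=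
  s1 (p1 e) + i1 (l.2 (p1 e)) + (e - s1 (p1 e)).

Lemma Flam0E l e : Flam0 l e = e + i0 (l.1 (p0 e)).
Proof. by rewrite /Flam0 addrC addrA subrK. Qed.

Lemma Flam1E l e : Flam1 l e = e + i1 (l.2 (p1 e)).
Proof. by rewrite /Flam1 addrC addrA subrK. Qed.

Lemma z1P (l : Z1) : cocycle1 rho l.
Proof. by case: l => l /= /asboolP. Qed.

Lemma Flam_hom (l : Z1) : xhom_axiom (Flam0 l) (Flam1 l).
Proof.
have [la lb h] := z1P l.
have h1 a : bdry ((z1val l).2 a) = (z1val l).1 (bdry a).
  by apply: subr0_eq; apply: (congr1 (fun c => theta c a) h).
have h2 x y : l00 rho x ((z1val l).1 y) + r00 rho y ((z1val l).1 x) = (z1val l).1 (brk x y).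
  by apply: subr0_eq; apply: (congr1 (fun c => omega c x y) h).
have h3 x a : l01 rho x ((z1val l).2 a) + r1 rho a ((z1val l).1 x) = (z1val l).2 (lact x a).
  by apply: subr0_eq; apply: (congr1 (fun c => mu c x a) h).
have h4 a x : l1 rho a ((z1val l).1 x) + r01 rho x ((z1val l).2 a) = (z1val l).2 (ract a x).
  by apply: subr0_eq; apply: (congr1 (fun c => nu c a x) h).
split.
- move=> k x y.
  by rewrite !Flam0E prj0_lin la inc0_lin scalerDr addrACA.
- move=> k x y.
  by rewrite !Flam1E prj1_lin lb inc1_lin scalerDr addrACA.
- move=> a.
  by rewrite Flam0E Flam1E (linD (@bdry_lin _)) -inc_bdry h1 prj_bdry.
- move=> x y; rewrite !Flam0E prj_brk -h2.
  rewrite (bilDl (@brk_bil _)) !(bilDr (@brk_bil _)) brk_inc_inc addr0.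
  by rewrite (linD inc0_lin) inc_l00 inc_r00 !addrA.
split=> [x a|a x]; rewrite !Flam1E Flam0E ?prj_lact ?prj_ract -?h3 -?h4.
- rewrite (bilDl (@lact_bil _)) !(bilDr (@lact_bil _)) lact_inc_inc addr0.
  by rewrite (linD inc1_lin) inc_l01 inc_r1 !addrA.
- rewrite (bilDl (@ract_bil _)) !(bilDr (@ract_bil _)) ract_inc_inc addr0.
  by rewrite (linD inc1_lin) inc_l1 inc_r01 !addrA.
Qed.

Lemma Flam0K (l : Z1) : cancel (Flam0 l) (Flam0 (- l)).
Proof.
move=> e; rewrite !Flam0E (linD prj0_lin) prj0_inc addr0.
by rewrite -addrA -(linD inc0_lin) subrr (lin0 inc0_lin) addr0.
Qed.

Lemma Flam1K (l : Z1) : cancel (Flam1 l) (Flam1 (- l)).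
Proof.
move=> e; rewrite !Flam1E (linD prj1_lin) prj1_inc addr0.
by rewrite -addrA -(linD inc1_lin) subrr (lin0 inc1_lin) addr0.
Qed.

Lemma Flam0_bij (l : Z1) : bijective (Flam0 l).
Proof.
exists (Flam0 (- l)); first exact: Flam0K.
by have := Flam0K (- l); rewrite opprK.
Qed.

Lemma Flam1_bij (l : Z1) : bijective (Flam1 l).
Proof.
exists (Flam1 (- l)); first exact: Flam1K.
by have := Flam1K (- l); rewrite opprK.
Qed.

Definition Flam (l : Z1) : xaut (mid E) :=
  XAut (Flam_hom l) (Flam0_bij l) (Flam1_bij l).

Lemma Flam_autV (l : Z1) : Flam l \in autV_pred.
Proof.
have [la lb _] := z1P l; apply/asboolP; split; apply: eq_image_id.
  move=> _ [v _ <-] /=.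
  by rewrite Flam0E prj0_inc (lin0 la) (lin0 inc0_lin) addr0.
move=> _ [v _ <-] /=.
by rewrite Flam1E prj1_inc (lin0 lb) (lin0 inc1_lin) addr0.
Qed.

Definition iZ1 (l : Z1) : AutV := MkAutV (Flam_autV l).

Definition restr0 (F : xaut (mid E)) (v : deg0 V) : deg0 V :=
  uninc0 (aut0 F (i0 v)).

Definition restr1 (F : xaut (mid E)) (m : deg1 V) : deg1 V :=
  uninc1 (aut1 F (i1 m)).

Definition bar0 (F : xaut (mid E)) (x : deg0 P) : deg0 P := p0 (aut0 F (s0 x)).

Definition bar1 (F : xaut (mid E)) (a : deg1 P) : deg1 P := p1 (aut1 F (s1 a)).

Lemma inc_restr0 (F : AutV) v : i0 (restr0 F v) = aut0 F (i0 v).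
Proof.
apply: uninc0K; apply/ext_exact0; have [h _] := autV_P F.
have : (aut0 F @` range i0) (aut0 F (i0 v)) by exists (i0 v) => //; exists v.
by rewrite h => -[w _ <-]; exists w.
Qed.

Lemma inc_restr1 (F : AutV) v : i1 (restr1 F v) = aut1 F (i1 v).
Proof.
apply: uninc1K; apply/ext_exact1; have [_ h] := autV_P F.
have : (aut1 F @` range i1) (aut1 F (i1 v)) by exists (i1 v) => //; exists v.
by rewrite h => -[w _ <-]; exists w.
Qed.

Lemma aut0D (A : xmod) (F : xaut A) : {morph aut0 F : x y / x + y}.
Proof. by have [h _ _ _ _] := aut_hom F; exact: linD. Qed.

Lemma aut1D (A : xmod) (F : xaut A) : {morph aut1 F : x y / x + y}.
Proof. by have [_ h _ _ _] := aut_hom F; exact: linD. Qed.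

Lemma bar0_prj (F : AutV) e : bar0 F (p0 e) = p0 (aut0 F e).
Proof.
have [v {2}->] := dec0 e.
by rewrite aut0D (linD prj0_lin) -inc_restr0 prj0_inc addr0.
Qed.

Lemma bar1_prj (F : AutV) e : bar1 F (p1 e) = p1 (aut1 F e).
Proof.
have [v {2}->] := dec1 e.
by rewrite aut1D (linD prj1_lin) -inc_restr1 prj1_inc addr0.
Qed.

Lemma restr_hom (F : AutV) : xhom_axiom (restr0 F) (restr1 F).
Proof.
have [f0 f1 f2 f3 [f4 f5]] := aut_hom F.
have [g0 g1 g2 g3 [g4 g5]] := inc_hom E.
split.
- move=> k x y; apply: (@inc0_inj _ _ E).
  by rewrite g0 !inc_restr0 g0 f0.
- move=> k x y; apply: (@inc1_inj _ _ E).
  by rewrite g1 !inc_restr1 g1 f1.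
- move=> a; apply: (@inc0_inj _ _ E).
  by rewrite inc_restr0 !g2 inc_restr1 f2.
- move=> x y; apply: (@inc0_inj _ _ E).
  by rewrite inc_restr0 !g3 !inc_restr0 f3.
split=> [x a|a x]; apply: (@inc1_inj _ _ E).
- by rewrite inc_restr1 !g4 inc_restr1 inc_restr0 f4.
- by rewrite inc_restr1 !g5 inc_restr1 inc_restr0 f5.
Qed.

Lemma restr0K (F : AutV) : cancel (restr0 F) (restr0 (F^-1)%g).
Proof.
by move=> v; apply: (@inc0_inj _ _ E); rewrite !inc_restr0 aut0K.
Qed.

Lemma restr1K (F : AutV) : cancel (restr1 F) (restr1 (F^-1)%g).
Proof.
by move=> v; apply: (@inc1_inj _ _ E); rewrite !inc_restr1 aut1K.
Qed.

Lemma bar0K (F : AutV) : cancel (bar0 F) (bar0 (F^-1)%g).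
Proof. by move=> x; rewrite bar0_prj aut0K sec0K. Qed.

Lemma bar1K (F : AutV) : cancel (bar1 F) (bar1 (F^-1)%g).
Proof. by move=> x; rewrite bar1_prj aut1K sec1K. Qed.

Lemma autV_bij (T : Type) (r : AutV -> T -> T) :
  (forall F, cancel (r F) (r (F^-1)%g)) -> forall F, bijective (r F).
Proof.
move=> h F; exists (r (F^-1)%g) => //.
by have := h (F^-1)%g; rewrite invgK.
Qed.

Lemma bar_hom (F : AutV) : xhom_axiom (bar0 F) (bar1 F).
Proof.
have [f0 f1 f2 f3 [f4 f5]] := aut_hom F.
split.
- move=> k x y; rewrite -[k *: x + y](sec0K s) bar0_prj sec0_lin f0.
  exact: prj0_lin.
- move=> k x y; rewrite -[k *: x + y](sec1K s) bar1_prj sec1_lin f1.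
  exact: prj1_lin.
- move=> a.
  by rewrite -{1}(sec1K s a) -prj_bdry bar0_prj f2 prj_bdry.
- move=> x y.
  by rewrite -{1}(sec0K s x) -{1}(sec0K s y) -prj_brk bar0_prj f3 prj_brk.
split=> [x a|a x].
- by rewrite -{1}(sec0K s x) -{1}(sec1K s a) -prj_lact bar1_prj f4 prj_lact.
- by rewrite -{1}(sec0K s x) -{1}(sec1K s a) -prj_ract bar1_prj f5 prj_ract.
Qed.

Definition restr (F : AutV) : xaut V :=
  XAut (restr_hom F) (autV_bij restr0K F) (autV_bij restr1K F).

Definition bar (F : AutV) : xaut P :=
  XAut (bar_hom F) (autV_bij bar0K F) (autV_bij bar1K F).

Lemma Phi_Crho (F : AutV) : (restr F, bar F) \in Crho_pred.
Proof.
have [_ _ _ f3 [f4 f5]] := aut_hom F.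
apply/asboolP/compatibleE; split=> [x w|x w|x m|x m|] /=.
- apply: (@inc0_inj _ _ E).
  by rewrite inc_restr0 sec_l00 f3 inc_l00 inc_restr0.
- apply: (@inc0_inj _ _ E).
  by rewrite inc_restr0 sec_r00 f3 inc_r00 inc_restr0.
- apply: (@inc1_inj _ _ E).
  by rewrite inc_restr1 sec_l01 f4 inc_l01 inc_restr1.
- apply: (@inc1_inj _ _ E).
  by rewrite inc_restr1 sec_r01 f5 inc_r01 inc_restr1.
split=> e w; apply: (@inc1_inj _ _ E).
- by rewrite inc_restr1 sec_r1 f4 inc_r1 inc_restr0.
- by rewrite inc_restr1 sec_l1 f5 inc_l1 inc_restr0.
Qed.

Definition Phi (F : AutV) : Crho := MkCrho (Phi_Crho F).

End Induced.

End CrossedModules.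

(* Main.v *)
(* Through the section, an automorphism of the middle term preserving V is a
   block-triangular map s x + i v |-> s (alpha x) + i (l (alpha x) + beta v), and
   conversely. For compatible (beta, alpha) and linear l, comparing the
   V-components shows that this map is a homomorphism of crossed modules exactly
   when twist beta alpha c - c = coboundary l. Taking alpha = beta = 1 identifies
   the kernel of Phi with Z^1, and letting l vary identifies its image with the
   zero set of the Wells map. *)
Require Import Defs.
From mathcomp Require Import all_boot all_algebra.
From mathcomp Require Import boolp classical_sets functions.

Set Implicit Arguments.
Unset Strict Implicit.
Unset Printing Implicit Defensive.

Import GRing.Theory.

Local Open Scope quotient_scope.
Local Open Scope ring_scope.

Arguments bdry_lin {K A}.
Arguments brk_bil {K A}.
Arguments lact_bil {K A}.
Arguments ract_bil {K A}.
Arguments inc0_lin {K V P E}.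
Arguments inc1_lin {K V P E}.
Arguments prj0_lin {K V P E}.
Arguments prj1_lin {K V P E}.
Arguments l00_bil {K V P E} s.
Arguments l01_bil {K V P E} s.
Arguments r00_bil {K V P E} s.
Arguments r01_bil {K V P E} s.
Arguments l1_bil {K V P E} s.
Arguments r1_bil {K V P E} s.

(** * Block-triangular maps on a split middle term *)

Section BlockMaps.
Variables (K : fieldType) (Q W M : lmodType K).
Variables (s : Q -> M) (i : W -> M) (p : M -> Q) (u : M -> W).
Hypothesis (s_lin : linear s) (i_lin : linear i).
Hypothesis (p_lin : linear p) (u_lin : linear u).
Hypothesis pE : forall x w, p (s x + i w) = x.
Hypothesis uE : forall x w, u (s x + i w) = w.
Hypothesis decE : forall e, s (p e) + i (u e) = e.

Definition block_map (a : Q -> Q) (b : W -> W) (l : Q -> W) (e : M) : M :=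
  s (a (p e)) + i (l (p e) + b (u e)).

Lemma block_mapE a b l x w :
  block_map a b l (s x + i w) = s (a x) + i (l x + b w).
Proof. by rewrite /block_map pE uE. Qed.

Lemma block_map_lin a b l :
  linear a -> linear b -> linear l -> linear (block_map a b l).
Proof.
move=> ha hb hl k x y; rewrite /block_map p_lin u_lin ha hb hl s_lin.
by rewrite addrACA -scalerDr i_lin scalerDr addrACA.
Qed.

(** Inverting a triangular matrix: the off-diagonal entry of the inverse is [- b^-1 l a^-1], which
    evaluated at [a x] gives the condition on [l']. *)
Lemma block_mapK a a' b b' l l' : cancel a a' -> cancel b b' ->
  linear b' -> (forall x, l' (a x) = - b' (l x)) ->
  cancel (block_map a b l) (block_map a' b' l').
Proof.
move=> aK bK b'_lin l'E e; rewrite -{1}(decE e) !block_mapE aK l'E.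
by rewrite (linD b'_lin) bK addKr decE.
Qed.

End BlockMaps.

(** * Coordinates on the middle term relative to the section *)

Section Lifting.
Variables (K : fieldType) (V P : xmod K).
Variables (E : abelian_extension V P) (s : section E).

Local Notation i0 := (@inc0 K V P E).
Local Notation i1 := (@inc1 K V P E).
Local Notation p0 := (@prj0 K V P E).
Local Notation p1 := (@prj1 K V P E).
Local Notation s0 := (@sec0 K V P E s).
Local Notation s1 := (@sec1 K V P E s).
Local Notation rho := (induced_rep s).
Local Notation cE := (induced_cocycle s).

Local Opaque induced_rep induced_cocycle.

(** The argument of [uninc0] lies in the kernel of [p0], so its default value is never reached. *)
Definition coord0 (e : deg0 (mid E)) : deg0 V := uninc0 (e - s0 (p0 e)).
Definition coord1 (e : deg1 (mid E)) : deg1 V := uninc1 (e - s1 (p1 e)).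

Lemma dec0E e : s0 (p0 e) + i0 (coord0 e) = e.
Proof.
by rewrite uninc0K ?subrKC // (linB prj0_lin) sec0K subrr.
Qed.

Lemma dec1E e : s1 (p1 e) + i1 (coord1 e) = e.
Proof.
by rewrite uninc1K ?subrKC // (linB prj1_lin) sec1K subrr.
Qed.

Lemma prj0_dec x v : p0 (s0 x + i0 v) = x.
Proof. by rewrite (linD prj0_lin) sec0K prj0_inc addr0. Qed.

Lemma prj1_dec x v : p1 (s1 x + i1 v) = x.
Proof. by rewrite (linD prj1_lin) sec1K prj1_inc addr0. Qed.

Lemma coord0_dec x v : coord0 (s0 x + i0 v) = v.
Proof. by rewrite /coord0 prj0_dec addrC addKr inc0K. Qed.

Lemma coord1_dec x v : coord1 (s1 x + i1 v) = v.
Proof. by rewrite /coord1 prj1_dec addrC addKr inc1K. Qed.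

(** [uninc0] is a chosen preimage, so linearity is drawn from uniqueness of coordinates: the
    combination of two decompositions is again a decomposition. *)
Lemma coord0_lin : linear coord0.
Proof.
move=> k x y; rewrite -{1}(dec0E x) -{1}(dec0E y) scalerDr addrACA.
by rewrite -sec0_lin -inc0_lin coord0_dec.
Qed.

Lemma coord1_lin : linear coord1.
Proof.
move=> k x y; rewrite -{1}(dec1E x) -{1}(dec1E y) scalerDr addrACA.
by rewrite -sec1_lin -inc1_lin coord1_dec.
Qed.

Lemma bdry_dec a m :
  bdry (s1 a + i1 m) = s0 (bdry a) + i0 (theta cE a + bdry m).
Proof.
by rewrite (linD bdry_lin) inc_theta -inc_bdry -addrA -(linD inc0_lin).
Qed.

Lemma brk_dec x u y v : brk (s0 x + i0 u) (s0 y + i0 v) =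
  s0 (brk x y) + i0 (omega cE x y + l00 rho x v + r00 rho y u).
Proof.
rewrite (bilDl brk_bil) !(bilDr brk_bil) brk_inc_inc addr0.
by rewrite inc_omega !(linD inc0_lin) sec_l00 sec_r00 !addrA.
Qed.

Lemma lact_dec x u a m : lact (s0 x + i0 u) (s1 a + i1 m) =
  s1 (lact x a) + i1 (mu cE x a + l01 rho x m + r1 rho a u).
Proof.
rewrite (bilDl lact_bil) !(bilDr lact_bil) lact_inc_inc addr0.
by rewrite inc_mu !(linD inc1_lin) sec_l01 sec_r1 !addrA.
Qed.

Lemma ract_dec a m x u : ract (s1 a + i1 m) (s0 x + i0 u) =
  s1 (ract a x) + i1 (nu cE a x + l1 rho a u + r01 rho x m).
Proof.
rewrite (bilDl ract_bil) !(bilDr ract_bil) ract_inc_inc addr0.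
by rewrite inc_nu !(linD inc1_lin) sec_l1 sec_r01 !addrA.
Qed.

(** * The homomorphism condition as a cocycle identity *)

Section TwistedIdentities.
Variables (b : xaut V) (a : xaut P) (l : cochain1 V P).
Hypothesis ba : intertwine s b a.

(* The equation twist b a cE - cE = coboundary l, read at the images under a
   and free of inverses and subtractions. *)
Definition twisted_cocycle : Prop :=
  [/\ forall e, l.1 (bdry (aut1 a e)) + aut0 b (theta cE e) =
        theta cE (aut1 a e) + bdry (l.2 (aut1 a e)),
      forall x y, l.1 (brk (aut0 a x) (aut0 a y)) + aut0 b (omega cE x y) =
        omega cE (aut0 a x) (aut0 a y)
        + (l00 rho (aut0 a x) (l.1 (aut0 a y))
           + r00 rho (aut0 a y) (l.1 (aut0 a x))),
      forall x e, l.2 (lact (aut0 a x) (aut1 a e)) + aut1 b (mu cE x e) =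
        mu cE (aut0 a x) (aut1 a e)
        + (l01 rho (aut0 a x) (l.2 (aut1 a e))
           + r1 rho (aut1 a e) (l.1 (aut0 a x)))
    & forall e x, l.2 (ract (aut1 a e) (aut0 a x)) + aut1 b (nu cE e x) =
        nu cE (aut1 a e) (aut0 a x)
        + (l1 rho (aut1 a e) (l.1 (aut0 a x))
           + r01 rho (aut0 a x) (l.2 (aut1 a e)))].

(** Since [a] is bijective, testing the four components only at images under [a] loses nothing. *)
Lemma twisted_cocycleE :
  twisted_cocycle <-> twist b a cE - cE = coboundary rho l.
Proof.
have subE (W : zmodType) (t v c z : W) : t + v = c + z <-> v - c = z - t.
  split=> h.
    by rewrite -(addrKA t v c) [v + t]addrC h [c + z]addrC [t + c]addrC addrKA.
  by rewrite -(subrK c v) h addrA subrKC addrC.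
split=> [[h1 h2 h3 h4] | h].
  congr (_, _, _, _).
  - apply: funext => e; apply: (subE _ _ _ _ _).1.
    by have := h1 (aut1 a^-1%g e); rewrite aut1VK.
  - apply: funext => x; apply: funext => y; apply: (subE _ _ _ _ _).1.
    by have := h2 (aut0 a^-1%g x) (aut0 a^-1%g y); rewrite !aut0VK.
  - apply: funext => x; apply: funext => e; apply: (subE _ _ _ _ _).1.
    by have := h3 (aut0 a^-1%g x) (aut1 a^-1%g e); rewrite aut0VK aut1VK.
  - apply: funext => e; apply: funext => x; apply: (subE _ _ _ _ _).1.
    by have := h4 (aut1 a^-1%g e) (aut0 a^-1%g x); rewrite aut0VK aut1VK.
split=> [e | x y | x e | e x]; apply: (subE _ _ _ _ _).2.
- apply: etrans (congr1 (fun c => theta c (aut1 a e)) h).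
  (* Writing [e] as [a^-1 (a e)] exhibits the value of the twisted cochain at [a e]. *)
  by rewrite -{1}[e](aut1K a).
- apply: etrans (congr1 (fun c => omega c (aut0 a x) (aut0 a y)) h).
  by rewrite -{1}[x](aut0K a) -{1}[y](aut0K a).
- apply: etrans (congr1 (fun c => mu c (aut0 a x) (aut1 a e)) h).
  by rewrite -{1}[x](aut0K a) -{1}[e](aut1K a).
- apply: etrans (congr1 (fun c => nu c (aut1 a e) (aut0 a x)) h).
  by rewrite -{1}[x](aut0K a) -{1}[e](aut1K a).
Qed.

Variables (G0 : deg0 (mid E) -> deg0 (mid E)).
Variables (G1 : deg1 (mid E) -> deg1 (mid E)).
Hypothesis G0_lin : linear G0.
Hypothesis G1_lin : linear G1.
Hypothesis G0E : forall x v,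
  G0 (s0 x + i0 v) = s0 (aut0 a x) + i0 (l.1 (aut0 a x) + aut0 b v).
Hypothesis G1E : forall e m,
  G1 (s1 e + i1 m) = s1 (aut1 a e) + i1 (l.2 (aut1 a e) + aut1 b m).

(** In coordinates the P-components agree because [a] is a homomorphism. In the V-components the
    terms involving V match by [ba] and because [b] commutes with [bdry]; what remains is the
    cocycle identity. *)
Lemma lift_homE : xhom_axiom G0 G1 <-> twisted_cocycle.
Proof.
have [k1 k2 k3 k4 [k5 k6]] := ba.
have [b1 b2 b3 b4 [b5 b6]] := aut_hom b.
have [a1 a2 a3 a4 [a5 a6]] := aut_hom a.
split=> [[_ _ g1 g2 [g3 g4]] | [h1 h2 h3 h4]].
  (* Evaluating at section elements, with zero V-component, isolates the cocycle identity. *)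
  split=> [e | x y | x e | e x].
  - have := g1 (s1 e + i1 0); rewrite bdry_dec G0E G1E bdry_dec.
    move=> /dec0_inj [_].
    by rewrite a3 (lin0 bdry_lin) (lin0 b2) !addr0.
  - have := g2 (s0 x + i0 0) (s0 y + i0 0); rewrite brk_dec !G0E brk_dec.
    move=> /dec0_inj [_].
    rewrite a4 (lin0 b1) !addr0 (bil0r (l00_bil s)) (bil0r (r00_bil s)).
    by rewrite !addr0 -addrA.
  - have := g3 (s0 x + i0 0) (s1 e + i1 0); rewrite lact_dec !G0E !G1E lact_dec.
    move=> /dec1_inj [_].
    rewrite a5 (lin0 b1) (lin0 b2) !addr0 (bil0r (l01_bil s)) (bil0r (r1_bil s)).
    by rewrite !addr0 -addrA.
  - have := g4 (s1 e + i1 0) (s0 x + i0 0); rewrite ract_dec !G0E !G1E ract_dec.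
    move=> /dec1_inj [_].
    rewrite a6 (lin0 b1) (lin0 b2) !addr0 (bil0r (l1_bil s)) (bil0r (r01_bil s)).
    by rewrite !addr0 -addrA.
(* Here [u] and [u'] stand for the action terms on V-components, which are added to both sides of
   the identity. *)
have addE (W : zmodType) (t v c z z' u u' : W) :
    t + v = c + (z + z') -> t + (v + u + u') = c + (z + u) + (z' + u').
  by move=> e; rewrite !addrA e !addrA [c + z + z' + u]addrAC.
split=> //.
- move=> e; rewrite -(dec1E e) bdry_dec G0E G1E bdry_dec a3.
  by rewrite (linD b1) b3 (linD bdry_lin) !addrA h1.
- move=> x y; rewrite -(dec0E x) -(dec0E y) brk_dec !G0E brk_dec a4; congr (_ + i0 _).
  rewrite !(linD b1) k1 k2 (bilDr (l00_bil s)) (bilDr (r00_bil s)).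
  exact/addE.
split=> [x e | e x]; rewrite -(dec0E x) -(dec1E e).
- rewrite lact_dec !G0E !G1E lact_dec a5; congr (_ + i1 _).
  rewrite !(linD b2) k3 k5 (bilDr (l01_bil s)) (bilDr (r1_bil s)).
  exact/addE.
- rewrite ract_dec !G0E !G1E ract_dec a6; congr (_ + i1 _).
  rewrite !(linD b2) k4 k6 (bilDr (l1_bil s)) (bilDr (r01_bil s)).
  exact/addE.
Qed.

End TwistedIdentities.

(** * The cochain attached to an automorphism preserving V *)

Definition deviation (F : AutV E) : cochain1 V P :=
  (fun x => coord0 (aut0 F (s0 (aut0 (bar s F)^-1%g x))),
   fun e => coord1 (aut1 F (s1 (aut1 (bar s F)^-1%g e)))).

Lemma deviation_lin F : linear (deviation F).1 /\ linear (deviation F).2.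
Proof.
have [f0 f1 _ _ _] := aut_hom F; have [g0 g1 _ _ _] := aut_hom (bar s F)^-1%g.
split.
  exact: lin_comp (lin_comp (lin_comp g0 (@sec0_lin _ _ _ _ s)) f0) coord0_lin.
exact: lin_comp (lin_comp (lin_comp g1 (@sec1_lin _ _ _ _ s)) f1) coord1_lin.
Qed.

(** The inverse of [bar s F] built into [deviation] cancels here, leaving the V-coordinate of
    [F (s0 x)]. This puts [F] in the block form required by [lift_homE]. *)
Lemma autV0_dec (F : AutV E) x v : aut0 F (s0 x + i0 v) =
  s0 (aut0 (bar s F) x)
  + i0 ((deviation F).1 (aut0 (bar s F) x) + aut0 (restr F) v).
Proof.
have -> : (deviation F).1 (aut0 (bar s F) x) =
    coord0 (aut0 F (s0 x)).
  by rewrite -{2}[x](aut0K (bar s F)).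
rewrite aut0D (linD inc0_lin) addrA.
by rewrite [s0 _ + _](dec0E (aut0 F (s0 x))) inc_restr0.
Qed.

Lemma autV1_dec (F : AutV E) x v : aut1 F (s1 x + i1 v) =
  s1 (aut1 (bar s F) x)
  + i1 ((deviation F).2 (aut1 (bar s F) x) + aut1 (restr F) v).
Proof.
have -> : (deviation F).2 (aut1 (bar s F) x) =
    coord1 (aut1 F (s1 x)).
  by rewrite -{2}[x](aut1K (bar s F)).
rewrite aut1D (linD inc1_lin) addrA.
by rewrite [s1 _ + _](dec1E (aut1 F (s1 x))) inc_restr1.
Qed.

Lemma deviation_coboundary F :
  twist (restr F) (bar s F) cE - cE = coboundary rho (deviation F).
Proof.
have ba := crhoP (Phi s F).
have [f0 f1 _ _ _] := aut_hom F.
apply/twisted_cocycleE.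
apply/(lift_homE ba f0 f1 (@autV0_dec F) (@autV1_dec F)); exact: aut_hom.
Qed.

(** * Vanishing of the Wells class *)

Lemma twist1 (c : cochain2 V P) : twist 1%g 1%g c = c.
Proof.
have h0 x : aut0 (1^-1)%g x = x :> deg0 P by rewrite invg1.
have h1 x : aut1 (1^-1)%g x = x :> deg1 P by rewrite invg1.
case: c => [[[t o] m] n]; congr (_, _, _, _).
- by apply: funext => e; rewrite h1.
- by apply: funext => x; apply: funext => y; rewrite !h0.
- by apply: funext => x; apply: funext => y; rewrite h0 h1.
- by apply: funext => x; apply: funext => y; rewrite h0 h1.
Qed.

(** Two classes in the quotient agree exactly when their representatives differ by an element of
    [B2], that is, by the coboundary of a linear cochain. *)
Lemma wells_eq0 (c : Crho s) : wells c = 0 <->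
  exists l : cochain1 V P, [/\ linear l.1, linear l.2
    & twist c.1 c.2 cE - cE = coboundary rho l].
Proof.
rewrite /wells; set z := mkZ2 _; set z' := mkZ2 _.
have -> : (\pi_(H2 s) z - \pi_(H2 s) z' = 0) <-> z - z' \in B2 (s := s).
  rewrite Quotient.idealrBE; split=> [/eqP | /eqP ->]; last by rewrite subrr.
  by rewrite subr_eq0.
by split=> [/asboolP | h]; last apply/asboolP.
Qed.

(** * Lifting compatible pairs with zero Wells class *)

Definition lift0 (c : Crho s) (l : cochain1 V P) :
    deg0 (mid E) -> deg0 (mid E) :=
  block_map s0 i0 p0 coord0 (aut0 c.2) (aut0 c.1) (l.1 \o aut0 c.2).

Definition lift1 (c : Crho s) (l : cochain1 V P) :
    deg1 (mid E) -> deg1 (mid E) :=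
  block_map s1 i1 p1 coord1 (aut1 c.2) (aut1 c.1) (l.2 \o aut1 c.2).

Lemma lift0_bij c l : bijective (lift0 c l).
Proof.
have [b0 _ _ _ _] := aut_hom c.1; have [b0' _ _ _ _] := aut_hom c.1^-1%g.
(* The off-diagonal entry [l alpha] of [lift0] makes that of the inverse [- beta^-1 l], as [alpha]
   cancels. *)
exists (block_map s0 i0 p0 coord0 (aut0 c.2^-1%g) (aut0 c.1^-1%g)
         (fun x => - aut0 c.1^-1%g (l.1 x))).
  exact: (block_mapK prj0_dec coord0_dec dec0E (aut0K _) (aut0K _)).
apply: (block_mapK prj0_dec coord0_dec dec0E (aut0VK _) (aut0VK _)) => //= x.
by rewrite (linN b0) aut0VK opprK aut0VK.
Qed.

Lemma lift1_bij c l : bijective (lift1 c l).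
Proof.
have [_ b1 _ _ _] := aut_hom c.1; have [_ b1' _ _ _] := aut_hom c.1^-1%g.
exists (block_map s1 i1 p1 coord1 (aut1 c.2^-1%g) (aut1 c.1^-1%g)
         (fun x => - aut1 c.1^-1%g (l.2 x))).
  exact: (block_mapK prj1_dec coord1_dec dec1E (aut1K _) (aut1K _)).
apply: (block_mapK prj1_dec coord1_dec dec1E (aut1VK _) (aut1VK _)) => //= x.
by rewrite (linN b1) aut1VK opprK aut1VK.
Qed.

Lemma lift_hom (c : Crho s) (l : cochain1 V P) :
  linear l.1 -> linear l.2 -> twist c.1 c.2 cE - cE = coboundary rho l ->
  xhom_axiom (lift0 c l) (lift1 c l).
Proof.
move=> hl0 hl1 /twisted_cocycleE h.
have [b0 b1 _ _ _] := aut_hom c.1; have [a0 a1 _ _ _] := aut_hom c.2.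
apply: (lift_homE (l := l) (crhoP c) _ _ _ _).2 h.
- apply: block_map_lin => //; first exact: sec0_lin.
  + exact: inc0_lin.
  + exact: prj0_lin.
  + exact: coord0_lin.
  + exact: lin_comp.
- apply: block_map_lin => //; first exact: sec1_lin.
  + exact: inc1_lin.
  + exact: prj1_lin.
  + exact: coord1_lin.
  + exact: lin_comp.
- exact: block_mapE prj0_dec coord0_dec _ _ _.
- exact: block_mapE prj1_dec coord1_dec _ _ _.
Qed.

Lemma lift0_inc c l v : linear l.1 -> lift0 c l (i0 v) = i0 (aut0 c.1 v).
Proof.
have [a0 _ _ _ _] := aut_hom c.2 => hl.
rewrite -[i0 v]add0r -(lin0 (@sec0_lin _ _ _ _ s)).
rewrite [LHS](block_mapE prj0_dec coord0_dec) /=.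
by rewrite (lin0 a0) (lin0 hl) (lin0 (@sec0_lin _ _ _ _ s)) !add0r.
Qed.

Lemma lift1_inc c l m : linear l.2 -> lift1 c l (i1 m) = i1 (aut1 c.1 m).
Proof.
have [_ a1 _ _ _] := aut_hom c.2 => hl.
rewrite -[i1 m]add0r -(lin0 (@sec1_lin _ _ _ _ s)).
rewrite [LHS](block_mapE prj1_dec coord1_dec) /=.
by rewrite (lin0 a1) (lin0 hl) (lin0 (@sec1_lin _ _ _ _ s)) !add0r.
Qed.

(** The block map built from [c] and [l] is the preimage: it acts on V by the first component of
    [c], and modulo V by the second. *)
Lemma Phi_lift (c : Crho s) (l : cochain1 V P) :
  linear l.1 -> linear l.2 -> twist c.1 c.2 cE - cE = coboundary rho l ->
  exists F : AutV E, Phi s F = c.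
Proof.
move=> hl0 hl1 hc.
pose F := XAut (lift_hom hl0 hl1 hc) (lift0_bij c l) (lift1_bij c l).
have FV : F \in autV_pred (E := E).
  apply/asboolP; split; apply/seteqP; split=> [_ [_ [v _ <-] <-]|_ [v _ <-]] /=.
  - by rewrite lift0_inc //; exists (aut0 c.1 v).
  (* The image is all of V because the first component of [c] is invertible on V. *)
  - exists (i0 (aut0 c.1^-1%g v)); first by exists (aut0 c.1^-1%g v).
    by rewrite lift0_inc // aut0VK.
  - by rewrite lift1_inc //; exists (aut1 c.1 v).
  - exists (i1 (aut1 c.1^-1%g v)); first by exists (aut1 c.1^-1%g v).
    by rewrite lift1_inc // aut1VK.
exists (MkAutV FV); apply: val_inj; apply: injective_projections => /=.
  apply: xaut_ext => v.
    by apply: (@inc0_inj _ _ _ E); rewrite inc_restr0 /= lift0_inc.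
  by apply: (@inc1_inj _ _ _ E); rewrite inc_restr1 /= lift1_inc.
apply: xaut_ext => x.
  rewrite /= /bar0 -[s0 x]addr0 -(lin0 inc0_lin) /=.
  by rewrite /lift0 (block_mapE prj0_dec coord0_dec) prj0_dec.
rewrite /= /bar1 -[s1 x]addr0 -(lin0 inc1_lin) /=.
by rewrite /lift1 (block_mapE prj1_dec coord1_dec) prj1_dec.
Qed.

(** * Injectivity of i, the homomorphism laws, and the kernel of Phi *)

Lemma iZ1_inj : injective (@iZ1 K V P E s).
Proof.
move=> l m e.
have e0 : aut0 (iZ1 l) =1 aut0 (iZ1 m) by rewrite e.
have e1 : aut1 (iZ1 l) =1 aut1 (iZ1 m) by rewrite e.
apply: val_inj; apply: injective_projections; apply: funext => x.
  have := e0 (s0 x); rewrite /= !Flam0E sec0K.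
  by move=> /addrI /inc0_inj.
have := e1 (s1 x); rewrite /= !Flam1E sec1K.
by move=> /addrI /inc1_inj.
Qed.

(** The shift made by [iZ1 m] lies in V and is invisible to the projection, so the two shifts simply
    add. *)
Lemma iZ1D (l m : Z1 s) : iZ1 (l + m) = (iZ1 l * iZ1 m)%g.
Proof.
apply: val_inj; apply: xaut_ext => x.
  rewrite [RHS]/= [LHS]Flam0E !Flam0E (linD prj0_lin) prj0_inc addr0 -addrA.
  by rewrite -(linD inc0_lin) [_ + (z1val l).1 _]addrC.
rewrite [RHS]/= [LHS]Flam1E !Flam1E (linD prj1_lin) prj1_inc addr0 -addrA.
by rewrite -(linD inc1_lin) [_ + (z1val l).2 _]addrC.
Qed.

Lemma PhiM (F G : AutV E) : Phi s (F * G)%g = (Phi s F * Phi s G)%g.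
Proof.
apply: val_inj; apply: injective_projections; apply: xaut_ext => x.
- by apply: (@inc0_inj _ _ _ E); rewrite !inc_restr0.
- by apply: (@inc1_inj _ _ _ E); rewrite !inc_restr1.
- by rewrite [RHS](bar0_prj s F).
- by rewrite [RHS](bar1_prj s F).
Qed.

(** An automorphism trivial on V and modulo V is determined by its [deviation], which serves as the
    preimage in [Z1]. *)
Lemma ker_Phi (F : AutV E) : Phi s F = 1%g <-> exists l : Z1 s, iZ1 l = F.
Proof.
split=> [h | [l <-]].
  have restr1F : restr F = 1%g by exact: (congr1 (fun c : Crho s => c.1) h).
  have bar1F : bar s F = 1%g by exact: (congr1 (fun c : Crho s => c.2) h).
  have [d0 d1] := deviation_lin F.
  have lP : deviation F \in Z1_pred s.
    apply/asboolP; split=> //.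
    (* With both induced automorphisms trivial the twist changes nothing, so the coboundary of the
       deviation is [cE - cE]. *)
    by rewrite -deviation_coboundary restr1F bar1F twist1 subrr.
  exists (MkZ1 lP); apply: val_inj; apply: xaut_ext => e.
    rewrite -[e in RHS](dec0E e) autV0_dec restr1F bar1F /=.
    by rewrite Flam0E -{1}(dec0E e) (linD inc0_lin) addrA addrAC.
  rewrite -[e in RHS](dec1E e) autV1_dec restr1F bar1F /=.
  by rewrite Flam1E -{1}(dec1E e) (linD inc1_lin) addrA addrAC.
have [l0 l1 _] := z1P l.
apply: val_inj; apply: injective_projections; apply: xaut_ext => x.
- apply: (@inc0_inj _ _ _ E); rewrite inc_restr0 /= Flam0E.
  by rewrite prj0_inc (lin0 l0) (lin0 inc0_lin) addr0.
- apply: (@inc1_inj _ _ _ E); rewrite inc_restr1 /= Flam1E.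
  by rewrite prj1_inc (lin0 l1) (lin0 inc1_lin) addr0.
- by rewrite /= /bar0 /= Flam0E (linD prj0_lin) prj0_inc addr0 sec0K.
- by rewrite /= /bar1 /= Flam1E (linD prj1_lin) prj1_inc addr0 sec1K.
Qed.

End Lifting.

Theorem theorem5p10 (K : fieldType) (V P : xmod K)
    (E : abelian_extension V P) (s : section E) :
  [/\ injective (@iZ1 K V P E s),
      forall l m : Z1 s, iZ1 (l + m) = (iZ1 l * iZ1 m)%g,
      forall F G : AutV E, Phi s (F * G)%g = (Phi s F * Phi s G)%g,
      forall F : AutV E, Phi s F = 1%g <-> exists l : Z1 s, iZ1 l = F
    & forall c : Crho s, wells c = 0 <-> exists F : AutV E, Phi s F = c].
Proof.
split; [exact: iZ1_inj | exact: iZ1D | exact: PhiM | exact: ker_Phi |].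
move=> c; split=> [/wells_eq0 [l [l0 l1 hl]] | [F <-]]; first exact: Phi_lift hl.
(* For a pair in the image of [Phi], the deviation of the given automorphism bounds the difference
   of the two cocycles. *)
have [l0 l1] := deviation_lin s F.
by apply/wells_eq0; exists (deviation s F); split=> //; exact: deviation_coboundary.
Qed.
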